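(* Thompson's group $F$ fixes exactly four profiles of $X_F$ under its action on profiles: $\Delta_L$, $\Delta_R$, $\Delta_{L-R}$ and $\Delta_\infty$.
   Context: Let $\mathcal P=\langle x\mid x=x^2\rangle$. Planar pictures over $\mathcal P$: a frame, transistors (each an $(x,x^2)$-transistor with one top and two bottom wires, or an $(x^2,x)$-transistor with two top and one bottom wire) and wires, each wire from the bottom of a transistor or top of the frame to the top of a transistor or bottom of the frame, embedded in the plane, with ''$T_1<T_2$ if a wire runs from the bottom of $T_1$ to the top of $T_2$'' generating a strict partial order. Dipoles: pairs $T_1<T_2$ with the bottom contacts of $T_1$ joined in order to the top contacts of $T_2$ and the top label of $T_1$ equal to the bottom label of $T_2$. $F$ is the group of reduced planar $(x,x)$-pictures under concatenation followed by dipole removal (Thompson's group). $X_F$: vertices are reduced planar $(x,* )$-pictures; $n$-cubes are such pictures with $n$ maximal transistors marked white, whose vertices are obtained by keeping/deleting each white transistor with its bottom wires; a CAT(0) cubical complex with an isometric $F$-action (concatenation on top, remove dipoles); base vertex $*$ has no transistors. Hyperplanes: classes of edges under the transitive closure of ''opposite sides of a square''; $H^+$ is the component of the complement of $H$ not containing $*$; $H_1^+\le H_2^+$ iff $H_2^+\subseteq H_1^+$. A profile is a nonempty collection of positive half-spaces such that finite subcollections have nonempty intersection, there is no maximal element, and it is downward closed. Action on profiles: for $g\in F$ and a profile $\mathcal H$, choose $\mathcal H'\subseteq\mathcal H$ cofinal (every element of $\mathcal H$ is $\le$ one of $\mathcal H'$) with $g\cdot H^+$ positive for all $H^+\in\mathcal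 H'$; $g*\mathcal H$ is the unique profile cofinal with $g\cdot\mathcal H'$. Minimal vertex $\min(H)$: for an edge of $H$ given by a picture with one white transistor $T$, the picture of all transistors $\le T$; any vertex with a unique maximal transistor is $\min(H)$ for a unique $H$. Finite ordered rooted binary trees (pictures with only $(x,x^2)$-transistors, ''carets'') are vertices. Label carets of the infinite full binary tree by binary strings (root = empty string; children of $s$ are $s0$ (left), $s1$ (right)). For a set $S$ of binary strings, let $P_S$ be the set of $H^+$ such that $\min(H)$ is the tree whose carets are exactly the prefixes of some $s\in S$. Then $\Delta_\infty=P_S$ with $S$ all binary strings; $\Delta_L=P_{\{0^k:k\ge0\}}$; $\Delta_R=P_{\{1^k:k\ge0\}}$; $\Delta_{L-R}=P_{\{0^k,1^k:k\ge0\}}$. *)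

(* Defs.v *)
(* Combinatorial model of the cube complex X_F of Thompson's group F,       *)
(* built from reduced planar pictures over < x | x = x^2 >.  *)
From Stdlib Require List Relations.Relation_Operators.
From mathcomp Require Import all_boot.

Set Implicit Arguments.
Unset Strict Implicit.
Unset Printing Implicit Defensive.

Notation rst := (@Relation_Operators.clos_refl_sym_trans _).

(* Finite ordered rooted binary trees: [Lf] is a bare wire, [Nd l r] is a
   caret, i.e. an (x,x^2)-transistor (read downwards) or, in a forest
   read upwards, an (x^2,x)-transistor. *)
Inductive tree : Type := Lf | Nd of tree & tree.

Fixpoint leaves (t : tree) : nat :=
  match t with Lf => 1 | Nd l r => leaves l + leaves r end.

(* A picture in normal form: first the (x,x^2)-transistors forming the tree
   [p.1] (top wire = top of the frame), then the (x^2,x)-transistors forming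
   the forest [p.2] read upside down; the roots of [p.2] are the bottom
   wires of the frame.  Every reduced planar (x,x^n)-picture over
   < x | x = x^2 > has a unique such form. *)
Definition pic := (tree * seq tree)%type.

Definition wf (p : pic) : Prop := leaves p.1 = sumn (map leaves p.2).

Fixpoint expt (t : tree) (k : nat) : tree :=
  match t with
  | Lf => if k == 0 then Nd Lf Lf else Lf
  | Nd l r => if k < leaves l then Nd (expt l k) r
              else Nd l (expt r (k - leaves l))
  end.

Fixpoint expf (f : seq tree) (k : nat) : seq tree :=
  match f with
  | [::] => [::]
  | t :: f' => if k < leaves t then expt t k :: f' else t :: expf f' (k - leaves t)
  end.

(* inserting a dipole (a split of wire k immediately followed by a merge) *)
Definition expand (p : pic) (k : nat) : pic := (expt p.1 k, expf p.2 k).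

Definition exp_step (p q : pic) : Prop :=
  wf p /\ exists k, k < leaves p.1 /\ q = expand p k.

Definition dequiv : pic -> pic -> Prop := rst exp_step.

Definition reduced (p : pic) : Prop :=
  wf p /\ ~ (exists q, exp_step q p).

Definition star : pic := (Lf, [:: Lf]).

(* Thompson's group F: reduced (x,x)-pictures *)
Definition inF (g : pic) : Prop := reduced g /\ size g.2 = 1.

(* action of g in F on a vertex: concatenate g on top of v and remove all
   dipoles; the result w is the reduced representative *)
Definition act (g v w : pic) : Prop :=
  reduced w /\
  exists A' B' Fo', dequiv g (A', [:: B']) /\ dequiv v (B', Fo')
                    /\ dequiv (A', Fo') w.

(* Maximal transistors, indexed by the bottom wires (roots of the forest):
   [MS j] : an (x,x^2)-transistor both of whose bottom wires are the
            frame bottom wires j and j+1;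
   [MM j] : the (x^2,x)-transistor whose bottom wire is frame bottom wire j. *)
Inductive mtrans : Type := MS of nat | MM of nat.

Definition del (p : pic) (t : mtrans) (q : pic) : Prop :=
  match t with
  | MS j => exists T0 f1 f2,
      p.2 = f1 ++ Lf :: Lf :: f2 /\ size f1 = j /\
      sumn (map leaves f1) < leaves T0 /\
      p.1 = expt T0 (sumn (map leaves f1)) /\
      q = (T0, f1 ++ Lf :: f2)
  | MM j => exists f1 l r f2,
      p.2 = f1 ++ Nd l r :: f2 /\ size f1 = j /\
      q = (p.1, f1 ++ l :: r :: f2)
  end.

Definition is_max (p : pic) (t : mtrans) : Prop := exists q, del p t q.

(* an edge = a reduced picture with one (maximal) transistor marked white *)
Definition edge (e : pic * mtrans) : Prop := reduced e.1 /\ is_max e.1 e.2.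

Definition mt_shift (t1 t2 : mtrans) : mtrans :=
  (* name of the maximal transistor t2 after deleting t1 *)
  let f k := match t1 with
             | MS j => if k < j then k else k.-1
             | MM j => if k < j then k else k.+1
             end in
  match t2 with MS k => MS (f k) | MM k => MM (f k) end.

(* a square: a reduced picture with two maximal transistors t1 <> t2 white;
   [opp e1 e2]: e1, e2 are opposite sides of a square *)
Definition opp (e1 e2 : pic * mtrans) : Prop :=
  exists p t1 t2 q2,
    reduced p /\ is_max p t1 /\ is_max p t2 /\ t1 <> t2 /\
    del p t2 q2 /\ e1 = (p, t1) /\ e2 = (q2, mt_shift t2 t1).

Definition sameH : pic * mtrans -> pic * mtrans -> Prop := rst opp.

Definition adj_off (e : pic * mtrans) (u w : pic) : Prop :=
  exists t, edge (u, t) /\ del u t w /\ ~ sameH (u, t) e.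

(* the positive half-space H^+ of the hyperplane H of e, as its vertex set:
   the vertices not connected to [star] in the complement of H *)
Definition hplus (e : pic * mtrans) : pic -> Prop :=
  fun v => reduced v /\ ~ rst (adj_off e) star v.

Definition hspace := pic -> Prop.

Definition positive (S : hspace) : Prop := exists e, edge e /\ S = hplus e.

Definition hle (S1 S2 : hspace) : Prop := forall v, S2 v -> S1 v.

Definition profile (H : hspace -> Prop) : Prop :=
  [/\ (exists S, H S),
      (forall S, H S -> positive S),
      (forall l : list hspace, (forall S, List.In S l -> H S) ->
          exists v, reduced v /\ forall S, List.In S l -> S v),
      (forall S, H S -> exists S', H S' /\ hle S S' /\ ~ hle S' S)
    & (forall S S', H S -> positive S' -> hle S' S -> H S')].

Definition gimg (g : pic) (S : hspace) : hspace :=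
  fun w => exists v, S v /\ act g v w.

Definition act_prof (g : pic) (H H2 : hspace -> Prop) : Prop :=
  exists H' : hspace -> Prop,
    (forall S, H' S -> H S) /\
    (forall S, H S -> exists S', H' S' /\ hle S S') /\
    (forall S, H' S -> positive (gimg g S)) /\
    profile H2 /\
    (forall S, H' S -> H2 (gimg g S)) /\
    (forall S2, H2 S2 -> exists S, H' S /\ hle S2 (gimg g S)).

Definition fixed_by_F (H : hspace -> Prop) : Prop :=
  forall g, inF g -> act_prof g H H.

(* binary strings: false = 0 (left), true = 1 (right); the tree whose carets
   are exactly the prefixes of s *)
Fixpoint path_tree (s : seq bool) : tree :=
  match s with
  | [::] => Nd Lf Lf
  | b :: s' => if b then Nd Lf (path_tree s') else Nd (path_tree s') Lf
  end.

Definition vtree (s : seq bool) : pic :=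
  (path_tree s, nseq (leaves (path_tree s)) Lf).

(* P_S: the H^+ with min(H) = vtree s, s in S.  vtree s has a unique maximal
   transistor t, and it is min(H) exactly for the hyperplane H of (vtree s, t). *)
Definition P_S (Sidx : seq bool -> Prop) : hspace -> Prop :=
  fun S => exists s, Sidx s /\ exists t, is_max (vtree s) t /\
            (forall t', is_max (vtree s) t' -> t' = t) /\ S = hplus (vtree s, t).

Definition Delta_inf := P_S (fun _ => True).
Definition Delta_L := P_S (fun s => exists k, s = nseq k false).
Definition Delta_R := P_S (fun s => exists k, s = nseq k true).
Definition Delta_LR := P_S (fun s => exists k, s = nseq k false \/ s = nseq k true).

(* Main.v *)
Require Import Defs.
From Stdlib Require Import Classical FunctionalExtensionality PropExtensionality.
From Stdlib Require Import Relation_Operators.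
From mathcomp Require Import all_boot zify.

Set Implicit Arguments.
Unset Strict Implicit.
Unset Printing Implicit Defensive.

(** A vertex (T, f) of X_F acts as a map [phi] from infinite binary words to
    pairs (bottom wire, infinite binary word): read an address of a leaf of T
    and rewrite it as the address of the same leaf in the forest f.  Crossing
    an edge splits or merges one bottom wire, and a hyperplane is determined
    by the inverse chart [th] of that wire: the half-space of [th] consists of
    the vertices v for which "some node of v lies above [th]" ([coarse]) has
    not the same truth value as at the base vertex.  An element g of F sends
    the chart th to g^-1 o th.  The hyperplanes whose minimal vertex is
    a tree are those with th = (x |-> s x) for a finite word s.

    If a fixed profile contained another half-space, of chart th, translating
    it by an element g supported on a small cone inside the image of th would
    give a half-space in the profile disjoint from it.  So a fixed profile is
    a set Y of finite words, closed under prefixes, without maximal element,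
    and invariant under F.  The elements of F supported on the cone of a word
    a, acting there by a00 -> a0, a01 -> a10, a1 -> a11, show that membership
    in Y depends only on which letters occur in a word, which leaves four
    possibilities. *)

(** * Infinite words and leaf addresses *)

Definition stream := nat -> bool.

Definition scons (b : bool) (x : stream) : stream :=
  fun n => if n is m.+1 then x m else b.

Definition stl (x : stream) : stream := fun n => x n.+1.

Definition sapp (s : seq bool) (x : stream) : stream := foldr scons x s.

Lemma scons_eta x : scons (x 0) (stl x) = x.
Proof. by apply: functional_extensionality; case. Qed.

Lemma scons_inj b c x y : scons b x = scons c y -> b = c /\ x = y.
Proof.
move=> E; split; first exact: (congr1 (fun z : stream => z 0) E).
exact: (congr1 stl E).
Qed.

Lemma sapp_cat s s' x : sapp (s ++ s') x = sapp s (sapp s' x).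
Proof. by rewrite /sapp foldr_cat. Qed.

Lemma sapp_injl s s' : (forall x, sapp s x = sapp s' x) -> s = s'.
Proof.
elim: s s' => [|b s IH] [|c s'] //= E.
- by have /(congr1 (fun z : stream => z 0)) /= := E (fun _ => ~~ c); case: (c).
- by have /(congr1 (fun z : stream => z 0)) /= := E (fun _ => ~~ b); case: (b).
have [<- _] := scons_inj (E (fun _ => false)).
by congr (_ :: _); apply: IH => x; have [] := scons_inj (E x).
Qed.

Notation width f := (sumn (map leaves f)).

(** A tree is a bijection from infinite words onto pairs of a leaf number and an infinite word, with
    inverse given by [addr]. *)
Fixpoint enc (t : tree) (x : stream) : nat * stream :=
  match t with
  | Lf => (0, x)
  | Nd l r => if x 0 then (leaves l + (enc r (stl x)).1, (enc r (stl x)).2)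
              else enc l (stl x)
  end.

Fixpoint addr (t : tree) (i : nat) : seq bool :=
  match t with
  | Lf => [::]
  | Nd l r => if i < leaves l then false :: addr l i
              else true :: addr r (i - leaves l)
  end.

(** Forests are read upwards, from a bottom wire to the leaves, numbered across the whole forest;
    [decf] reads downwards. *)
Fixpoint encf (f : seq tree) (j : nat) (x : stream) : nat * stream :=
  match f with
  | [::] => (0, x)
  | t :: f' => if j is j'.+1 then (leaves t + (encf f' j' x).1, (encf f' j' x).2)
               else enc t x
  end.

Fixpoint faddr (f : seq tree) (i : nat) : nat * seq bool :=
  match f with
  | [::] => (0, [::])
  | t :: f' => if i < leaves t then (0, addr t i)
               else ((faddr f' (i - leaves t)).1.+1, (faddr f' (i - leaves t)).2)
  end.

Definition decf (f : seq tree) (q : nat * stream) : nat * stream :=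
  ((faddr f q.1).1, sapp (faddr f q.1).2 q.2).

Definition phi (p : pic) (z : stream) : nat * stream := decf p.2 (enc p.1 z).

(* Splitting output wire [k] into its two halves [k] and [k + 1]. *)
Definition spl (k : nat) (q : nat * stream) : nat * stream :=
  if q.1 < k then q else
  if q.1 == k then (k + q.2 0, stl q.2) else (q.1.+1, q.2).

Lemma leaves_gt0 t : 0 < leaves t.
Proof. by elim: t => //= l Hl r _; rewrite addn_gt0 Hl. Qed.

Lemma enc_lt t x : (enc t x).1 < leaves t.
Proof.
elim: t x => //= l IHl r IHr x; case: (x 0) => /=; first by rewrite ltn_add2l.
exact: ltn_addr.
Qed.

Lemma addr_enc t x : sapp (addr t (enc t x).1) (enc t x).2 = x.
Proof.
elim: t x => //= l IHl r IHr x; rewrite -[RHS]scons_eta.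
case E: (x 0) => /=; last by rewrite enc_lt /= IHl.
by rewrite ltnNge leq_addr /= addKn IHr.
Qed.

Lemma enc_addr t i x : i < leaves t -> enc t (sapp (addr t i) x) = (i, x).
Proof.
elim: t i x => [|l IHl r IHr] i x /=; first by case: i.
move=> it; case: (ltnP i (leaves l)) => /= il; first exact: IHl.
by rewrite [enc r _]IHr /= ?subnKC // ltn_subLR.
Qed.

Lemma enc_inj t x y : enc t x = enc t y -> x = y.
Proof. by move=> E; rewrite -(addr_enc t x) E addr_enc. Qed.

Lemma encf_lt f j x : j < size f -> (encf f j x).1 < width f.
Proof.
elim: f j => //= t f IH [|j] /= jf; first exact/ltn_addr/enc_lt.
by rewrite ltn_add2l; apply: IH.
Qed.

Lemma decf_encf f j x : j < size f -> decf f (encf f j x) = (j, x).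
Proof.
elim: f j => //= t f IH [|j] /= jf; first by rewrite /decf /= enc_lt /= addr_enc.
by move/IH: jf => [E1 E2]; rewrite /decf /= ltnNge leq_addr /= addKn E1 E2.
Qed.

Lemma faddr_lt f i : i < width f -> (faddr f i).1 < size f.
Proof.
elim: f i => //= t f IH i; move=> itf; case: (ltnP i (leaves t)) => //= ti.
by rewrite ltnS; apply: IH; rewrite ltn_subLR.
Qed.

Lemma encf_decf f q : q.1 < width f -> encf f (decf f q).1 (decf f q).2 = q.
Proof.
rewrite /decf; case: q => i x /=; elim: f i => //= t f IH i.
move=> itf; case: (ltnP i (leaves t)) => /= ti; first by rewrite enc_addr.
by rewrite IH /= ?subnKC // ltn_subLR.
Qed.

Lemma phi_lt p z : wf p -> (phi p z).1 < size p.2.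
Proof. by move=> Hp; apply: faddr_lt; rewrite -Hp enc_lt. Qed.

Lemma phi_enc p z : wf p -> encf p.2 (phi p z).1 (phi p z).2 = enc p.1 z.
Proof. by move=> Hp; rewrite encf_decf // -Hp enc_lt. Qed.

Lemma phi_eq p z j y : wf p -> j < size p.2 -> enc p.1 z = encf p.2 j y -> phi p z = (j, y).
Proof. by move=> Hp jp E; rewrite /phi E decf_encf. Qed.

Lemma phi_inj p z z' : wf p -> phi p z = phi p z' -> z = z'.
Proof. by move=> Hp E; apply: (@enc_inj p.1); rewrite -!phi_enc // E. Qed.

Lemma phi_surj p j y : wf p -> j < size p.2 -> exists z, phi p z = (j, y).
Proof.
move=> Hp jp; exists (sapp (addr p.1 (encf p.2 j y).1) (encf p.2 j y).2).
by apply: phi_eq => //; rewrite enc_addr -?surjective_pairing // Hp encf_lt.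
Qed.

Lemma spl_inj k q q' : spl k q = spl k q' -> q = q'.
Proof.
(* A left inverse: wires [k] and [k + 1] merge and the letter telling them apart is put back. *)
pose unspl (q : nat * stream) := if q.1 < k then q else
  if q.1 <= k.+1 then (k, scons (q.1 == k.+1) q.2) else (q.1.-1, q.2).
suff K : cancel (spl k) unspl by move=> E; rewrite -(K q) E K.
case=> i x; rewrite /spl /unspl /=; case: (ltnP i k) => [/= -> //|ki].
case: eqP => [-> | ik] /=; last by rewrite !ifF //; lia.
rewrite ifF ?ifT; try by case: (x 0); lia.
congr pair; rewrite -[RHS]scons_eta; congr scons.
by case: (x 0); lia.
Qed.

(** * Insertion and removal of dipoles *)

Lemma leaves_expt t k : k < leaves t -> leaves (expt t k) = (leaves t).+1.
Proof.
elim: t k => [|l IHl r IHr] k /=; first by case: k.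
move=> klr; case: (ltnP k (leaves l)) => /= kl; first by rewrite IHl.
by rewrite IHr ?addnS // ltn_subLR.
Qed.

Lemma enc_expt t k x : k < leaves t -> enc (expt t k) x = spl k (enc t x).
Proof.
elim: t k x => [|l IHl r IHr] k x /=.
  by case: k => //= _; rewrite /spl /=; case: (x 0).
move=> klr; case: (ltnP k (leaves l)) => /= kl.
  rewrite leaves_expt //; case: (x 0); last exact: IHl.
  by rewrite /spl /= ifF ?ifF //; lia.
rewrite IHr ?ltn_subLR //; case: (x 0); rewrite /spl /=.
  move: (enc r _) => [i y] /=.
  rewrite ltn_subRL -(eqn_add2l (leaves l)) subnKC //.
  case: ifP => // _; case: ifP => /= _; rewrite ?addnA ?subnKC //; congr pair; lia.
by have := enc_lt l (stl x) => H; rewrite ifT //; lia.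
Qed.

Lemma size_expf f k : size (expf f k) = size f.
Proof. by elim: f k => //= t f IH k; case: ifP => //= _; rewrite IH. Qed.

Lemma width_expf f k : k < width f -> width (expf f k) = (width f).+1.
Proof.
elim: f k => //= t f IH k kf; case: (ltnP k (leaves t)) => /= kt; first by rewrite leaves_expt.
by rewrite IH ?addnS // ltn_subLR.
Qed.

Lemma encf_expf f k j x :
  k < width f -> j < size f -> encf (expf f k) j x = spl k (encf f j x).
Proof.
elim: f k j => //= t f IH k [|j] kf jf; case: (ltnP k (leaves t)) => /= kt.
- exact: enc_expt.
- by rewrite /spl ifT //; have := enc_lt t x; lia.
- by rewrite leaves_expt // /spl /= !ifF //; lia.
rewrite IH ?ltn_subLR // /spl /=; move: (encf f j x) => [i y] /=.
rewrite ltn_subRL -(eqn_add2l (leaves t)) subnKC //.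
case: ifP => // _; case: ifP => /= _; rewrite ?addnA ?subnKC //; congr pair; lia.
Qed.

Lemma wf_expand p k : k < leaves p.1 -> wf p -> wf (expand p k).
Proof. by move=> kp Hp; rewrite /wf /= leaves_expt // width_expf -?Hp. Qed.

(** The new carets compose [enc] and [encf] with the same [spl k], so the equation that determines
    [phi] persists. *)
Lemma phi_expand p k : wf p -> k < leaves p.1 -> phi (expand p k) = phi p.
Proof.
move=> Hp kp; apply: functional_extensionality => z.
rewrite [RHS]surjective_pairing; apply: phi_eq.
- exact: wf_expand.
- by rewrite size_expf phi_lt.
by rewrite /= enc_expt // encf_expf ?phi_lt ?phi_enc // -Hp.
Qed.

Lemma exp_step_phi p q : exp_step p q -> phi q = phi p /\ size q.2 = size p.2.
Proof. by case=> Hp [k [kp ->]]; rewrite phi_expand //= size_expf. Qed.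

Lemma exp_step_wf p q : exp_step p q -> wf p /\ wf q.
Proof. by case=> Hp [k [kp ->]]; split => //; apply: wf_expand. Qed.

Lemma dequiv_phi p q : dequiv p q -> phi q = phi p /\ size q.2 = size p.2.
Proof.
elim=> {p q} [p q /exp_step_phi //|//|p q _ [-> ->] //|p q r _ [-> ->] _ [-> ->] //].
Qed.

Lemma dequiv_wf p q : dequiv p q -> wf p <-> wf q.
Proof.
elim=> {p q} [p q /exp_step_wf [] //|//|p q _ -> //|p q r _ -> _ -> //].
Qed.

Lemma wf_reduce p : wf p -> exists2 q, reduced q & dequiv p q.
Proof.
have [n] := ubnP (leaves p.1); elim: n p => // n IH p pn Hp.
case: (classic (exists q, exp_step q p)) => [[q Hq]|no]; last first.
  by exists p; [split|apply: rst_refl].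
have [Hq1 _] := exp_step_wf Hq.
case: (IH q) => // [|r rr qr].
  by case: Hq => _ [k [kq E]]; move: pn; rewrite E /= leaves_expt.
exists r => //; apply: rst_trans qr; exact/rst_sym/rst_step.
Qed.

(** * Deletion of a maximal transistor *)

Lemma spl_lt k q n : q.1 < n -> (spl k q).1 < n.+1.
Proof.
case: q => i x; rewrite /spl /=; case: ifP => /= _; first exact: ltnW.
by case: eqP => //= -> kn; case: (x 0); lia.
Qed.

(** Cutting a root caret doubles one bottom wire but leaves the numbering of the leaves
    unchanged. *)
Lemma encf_split f1 l r f2 q :
  q.1 < size (f1 ++ Nd l r :: f2) ->
  encf (f1 ++ l :: r :: f2) (spl (size f1) q).1 (spl (size f1) q).2 =
  encf (f1 ++ Nd l r :: f2) q.1 q.2.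
Proof.
case: q => j x; rewrite /spl /=; elim: f1 j => [|t f1 IH] [|j] jf //=.
  by rewrite add0n; case: (x 0) => //=.
- by rewrite addnA.
move/IH: jf; rewrite ltnS eqSS; case: ifP => _ /=; first by move=> ->.
by case: ifP => _ /= ->.
Qed.

Lemma expf_root f1 f2 : expf (f1 ++ Lf :: f2) (width f1) = f1 ++ Nd Lf Lf :: f2.
Proof.
elim: f1 => //= t f1 IH; rewrite ifF ?addKn ?IH //; lia.
Qed.

Lemma width_cat f1 f2 : width (f1 ++ f2) = width f1 + width f2.
Proof. by rewrite map_cat sumn_cat. Qed.

(** Deleting a split leads to the coarser end of an edge, deleting a merge to the finer one. *)
Definition coarser (j : nat) (c d : pic) := forall z, phi d z = spl j (phi c z).

Lemma del_wf p t q : wf p -> del p t q -> wf q.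
Proof.
rewrite /wf; case: t => j /=.
  move=> Hp [T0 [f1 [f2 [E1 [_ [k1 [E2 ->]]]]]]]; move: Hp.
  by rewrite E1 E2 leaves_expt //= !width_cat /=; lia.
move=> Hp [f1 [l [r [f2 [E1 [_ ->]]]]]]; move: Hp.
by rewrite E1 /= !width_cat /=; lia.
Qed.

Lemma del_MS p j q : wf p -> del p (MS j) q -> coarser j q p.
Proof.
move=> Hp Hd z; have Hq := del_wf Hp Hd; move: (phi_lt z Hq) (phi_enc z Hq).
case: Hd => T0 [f1 [f2 [E1 [E2 [k1 [E3 ->]]]]]] /=; set q' := (T0, _) => jlt E.
rewrite [RHS]surjective_pairing; apply: phi_eq => //.
  by rewrite E1 size_cat /= addnS; apply: spl_lt; rewrite size_cat /= in jlt.
have jlt' : (phi q' z).1 < size (f1 ++ Nd Lf Lf :: f2) by move: jlt; rewrite !size_cat.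
(* The caret that [p.1] has beyond [T0] becomes a root caret of the forest, and cutting it divides
   wire [j]. *)
rewrite E1 E3 enc_expt // -E -E2.
rewrite encf_split // -expf_root encf_expf // width_cat /=; lia.
Qed.

Lemma del_MM p j q : wf p -> del p (MM j) q -> coarser j p q.
Proof.
move=> Hp Hd z; have Hq := del_wf Hp Hd; move: (phi_lt z Hp) (phi_enc z Hp).
case: Hd Hq => f1 [l [r [f2 [E1 [E2 ->]]]]] Hq jlt E.
rewrite [RHS]surjective_pairing; apply: phi_eq => //=.
  by rewrite size_cat /= addnS; apply: spl_lt; rewrite E1 size_cat /= in jlt.
by rewrite -E -E2 E1 encf_split // -E1.
Qed.

(* [th] is an inverse chart, i.e. it maps the interval of a wire back into the
   frame top; [coarse th v] says that this wire is a node of the forest of [v]. *)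
Definition coarse (th : stream -> stream) (v : pic) : Prop :=
  exists k c, forall x, phi v (th x) = (k, sapp c x).

(** * Carets of a tree, and a criterion for reducedness *)

Fixpoint int (t : tree) (s : seq bool) : bool :=
  match t, s with
  | Lf, _ => false
  | Nd _ _, [::] => true
  | Nd l r, b :: s' => int (if b then r else l) s'
  end.

Lemma int_prefix t s s' : int t (s ++ s') -> int t s.
Proof. by elim: t s => [|l IHl r IHr] [|[] s] //=; [apply: IHr | apply: IHl]. Qed.

Lemma intN_enc t s : ~~ int t s ->
  exists i c, s = addr t i ++ c /\ forall x, enc t (sapp s x) = (i, sapp c x).
Proof.
elim: t s => [|l IHl r IHr] [|b s] //=; [by exists 0, [::] | by exists 0, (b :: s) |].
case: b => /= [/IHr|/IHl] [i [c [-> E]]].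
  exists (leaves l + i), c; rewrite ifF ?addKn; last by lia.
  by split => // x; rewrite [enc r _]E.
exists i, c; have := enc_lt l (sapp (addr l i ++ c) (fun=> false)).
by rewrite E /= => il; rewrite il; split => // x; exact: E.
Qed.

Lemma intN_coarse p s : ~~ int p.1 s -> coarse (sapp s) p.
Proof.
case/intN_enc=> i [c [_ E]]; exists (faddr p.2 i).1, ((faddr p.2 i).2 ++ c) => x.
by rewrite /phi E /decf /= sapp_cat.
Qed.

Lemma int_addr t k : k < leaves t -> ~~ int t (addr t k).
Proof.
elim: t k => //= l IHl r IHr k klr.
by case: (ltnP k (leaves l)) => kl /=; [apply: IHl|apply: IHr; rewrite ltn_subLR].
Qed.

Lemma int_expt t k s : k < leaves t -> int (expt t k) s = int t s || (s == addr t k).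
Proof.
elim: t k s => [|l IHl r IHr] k [|b s] //=; try by case: k => //; case: b.
  by case: (ltnP k (leaves l)).
move=> klr; case: (ltnP k (leaves l)) => kl /=; case: b; rewrite ?eqseq_cons ?andbF ?orbF //=.
- exact: IHl.
- by rewrite IHr // ltn_subLR.
Qed.

(** Going down from [s] through carets ends at one with two bare leaves; [t0] is the tree without it
    and [s ++ d] its address. *)
Lemma bottom_caret t s : int t s ->
  exists t0 k d, [/\ k < leaves t0, t = expt t0 k & addr t0 k = s ++ d].
Proof.
elim: t s => //= l IHl r IHr s Hs.
have L s' : int l s' -> exists t0 k d,
  [/\ k < leaves t0, Nd l r = expt t0 k & addr t0 k = false :: s' ++ d].
  move/IHl=> [t0 [k [d [kt -> E]]]]; exists (Nd t0 r), k, d => /=.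
  by rewrite kt E; split => //; apply: ltn_addr.
have R s' : int r s' -> exists t0 k d,
  [/\ k < leaves t0, Nd l r = expt t0 k & addr t0 k = true :: s' ++ d].
  move/IHr=> [t0 [k [d [kt -> E]]]]; exists (Nd l t0), (leaves l + k), d => /=.
  have -> : (leaves l + k < leaves l) = false by lia.
  by rewrite addKn E ltn_add2l.
case: s Hs => [_|b s]; last first.
  by case: b => [/R|/L] [t0 [k [d ?]]]; exists t0, k, d.
case: l L R {IHl IHr} => [|l1 l2] L R.
  case: r R {L} => [|r1 r2] R; first by exists Lf, 0, [::].
  by case: (R [::] isT) => t0 [k [d []]]; exists t0, k, (true :: d).
by case: (L [::] isT) => t0 [k [d []]]; exists t0, k, (false :: d).
Qed.

Lemma enc_const t k : (forall y, enc t y = (k, y)) -> t = Lf /\ k = 0.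
Proof.
move=> H; have k0 := congr1 fst (H (sapp (addr t 0) (fun=> true))).
rewrite enc_addr ?leaves_gt0 //= in k0; split => //.
have {}H x : sapp (addr t 0) x = sapp [::] x.
  by have := H (sapp (addr t 0) x); rewrite enc_addr ?leaves_gt0 // => -[_ /= <-].
by case: t H {k0} => // l r /sapp_injl /=; rewrite leaves_gt0.
Qed.

(** Recognises a caret with two bare leaves from the map alone: the cone of [c] fills exactly the
    leaves [k] and [k + 1]. *)
Lemma enc_caret t k c : (forall x, enc t (sapp c x) = (k + x 0, stl x)) ->
  exists t0, t = expt t0 k /\ k < leaves t0.
Proof.
elim: t k c => [|l IHl r IHr] k c H.
  by have := congr1 fst (H (fun=> true)) => /=; rewrite addn1.
case: c H => [|[] c] H.
- have [-> k0] : l = Lf /\ k = 0.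
    by apply: enc_const => y; have := H (scons false y); rewrite /= addn0.
  subst k; have [-> _] : r = Lf /\ 1 - leaves l = 0.
    apply: enc_const => y; have := H (scons true y); rewrite /= add0n => E.
    case: E => E1; rewrite -[stl _]/y => E2; rewrite [LHS]surjective_pairing E2.
    by congr pair; rewrite -E1 addKn.
  by exists Lf.
- have lk : leaves l <= k.
    by have := congr1 fst (H (fun=> false)) => /=; rewrite addn0 => <-; rewrite leq_addr.
  case: (IHr (k - leaves l) c) => [x|t0 [-> kt]].
    have [E1 E2] := H x; rewrite [LHS]surjective_pairing -E2; congr pair => //.
    by have := E1; rewrite -[stl _]/(sapp c x); lia.
  exists (Nd l t0) => /=; rewrite ifF ?ltn_add2l //; last by lia.
  by split => //; lia.
have kl : k < leaves l.
  by have := congr1 fst (H (fun=> false)) => /=; rewrite addn0 => <-; exact: enc_lt.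
case: (IHl k c) => [x|t0 [-> kt]]; first exact: (H x).
by exists (Nd t0 r) => /=; rewrite kt; split => //; apply: ltn_addr.
Qed.

Lemma encf_caret f j k c : j < size f ->
  (forall x, encf f j (sapp c x) = (k + x 0, stl x)) ->
  exists f0, f = expf f0 k /\ k < width f0.
Proof.
elim: f j k => //= t f IH [|j] k jf H.
  case: (enc_caret H) => t0 [-> kt]; exists (t0 :: f) => /=.
  by rewrite kt; split => //; apply: ltn_addr.
have lk : leaves t <= k.
  by have := congr1 fst (H (fun=> false)) => /=; rewrite addn0 => <-; rewrite leq_addr.
case: (IH j (k - leaves t)) => // [x|f0 [-> kf]].
  have [E1 E2] := H x; rewrite [LHS]surjective_pairing E2; congr pair; lia.
exists (t :: f0); rewrite /=; have -> : (k < leaves t) = false by lia.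
by split => //; lia.
Qed.

(** If the cone of a caret [s] were coarse, a bottom caret of the tree at or below [s] would face a
    caret of the forest with the same two leaves, which is a dipole. So the tree of a reduced
    picture is determined by [phi]. *)
Lemma reduced_int p s : reduced p -> int p.1 s <-> ~ coarse (sapp s) p.
Proof.
case=> Hp Hno; split; last first.
  by move=> nc; apply/negPn/negP => /intN_coarse.
move=> /bottom_caret [t0 [k [d [kt E Ed]]]] [j [c Hc]]; apply: Hno.
have jp : j < size p.2 by have := phi_lt (sapp s (fun=> false)) Hp; rewrite Hc.
case: (@encf_caret p.2 j k (c ++ d)) => // [x|f0 [Ef kf]].
  have Hx : phi p (sapp (addr t0 k) x) = (j, sapp (c ++ d) x).
    by rewrite Ed !sapp_cat Hc.
  have := phi_enc (sapp (addr t0 k) x) Hp; rewrite Hx /= => ->.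
  by rewrite E enc_expt // enc_addr // /spl /= ltnn eqxx.
exists (t0, f0); split.
  by move: Hp; rewrite /wf E Ef /= leaves_expt // width_expf // => -[].
by exists k; split => //; rewrite [p]surjective_pairing E Ef.
Qed.

Lemma int_reduced p : wf p -> (forall s, int p.1 s -> ~ coarse (sapp s) p) -> reduced p.
Proof.
move=> Hp H; split => // -[q [Hq [k [kq E]]]]; apply: (H (addr q.1 k)).
  by rewrite E /= int_expt // eqxx orbT.
rewrite E /coarse phi_expand //; apply: intN_coarse; exact: int_addr.
Qed.

(** * Charts of edges *)

Definition chart (p : pic) (j : nat) (x : stream) : stream :=
  sapp (addr p.1 (encf p.2 j x).1) (encf p.2 j x).2.

Lemma phi_chart p j x : wf p -> j < size p.2 -> phi p (chart p j x) = (j, x).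
Proof.
move=> Hp jp; apply: phi_eq => //.
by rewrite enc_addr -?surjective_pairing // Hp encf_lt.
Qed.

Lemma encf_root f1 t f2 x :
  encf (f1 ++ t :: f2) (size f1) x = (width f1 + (enc t x).1, (enc t x).2).
Proof. by elim: f1 => /= [|t' f1 ->]; rewrite -?surjective_pairing //= addnA. Qed.

(** The two halves of the divided wire carry different numbers, so no single wire of [d] receives
    all of [th]. *)
Lemma flip_self c d j th :
  coarser j c d -> (forall x, phi c (th x) = (j, x)) -> coarse th c /\ ~ coarse th d.
Proof.
move=> cd H; split; first by exists j, [::].
case=> k [s Hs]; have E (b : bool) : k = j + b.
  by have := Hs (fun=> b); rewrite cd H /spl /= ltnn eqxx => -[].
by have := E true; rewrite (E false); lia.
Qed.

(* Together with [flip_self]: the edge from [c] to [d] crosses only the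
   hyperplane of its own chart. *)
Lemma flip_other c d j th th' : wf c -> coarser j c d ->
  (forall x, phi c (th x) = (j, x)) -> th' <> th -> coarse th' c <-> coarse th' d.
Proof.
move=> Hc cd H ne; split; case=> k [s Hs].
  case: (ltngtP k j) => kj; last first.
  - subst k; case: s Hs => [|b s] Hs.
      case: ne; apply: functional_extensionality => x.
      by apply: (@phi_inj c) => //; rewrite Hs H.
    by exists (j + b), s => x; rewrite cd Hs /spl /= ltnn eqxx.
  - by exists k.+1, s => x; rewrite cd Hs /spl /= !ifF //; lia.
  - by exists k, s => x; rewrite cd Hs /spl /= kj.
have {}Hs x : spl j (phi c (th' x)) = (k, sapp s x) by rewrite -cd.
case: (ltnP k j) => kj.
  exists k, s => x; apply: (@spl_inj j); rewrite Hs /spl /= kj //.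
case: (leqP k j.+1) => kj'; last first.
  by exists k.-1, s => x; apply: (@spl_inj j); rewrite Hs /spl /= !ifF ?prednK //; lia.
exists j, ((k == j.+1) :: s) => x; apply: (@spl_inj j).
by rewrite Hs /spl /= ltnn eqxx; congr pair; lia.
Qed.

(* [th] is the inverse chart of the undivided wire at the edge (p, t): the
   top wire of [t] if [t] is a split, its bottom wire if it is a merge. *)
Definition label (p : pic) (t : mtrans) (th : stream -> stream) : Prop :=
  forall x, phi p (th x) = match t with MS j => (j + x 0, stl x) | MM j => (j, x) end.

Definition standard (th : stream -> stream) : Prop := exists s, th = sapp s.

(** The condition that deleting [t] leads to the side of the base vertex, which is coarse for [th]
    exactly when [th] is standard. *)
Definition kind (t : mtrans) (th : stream -> stream) : Prop :=
  match t with MS _ => standard th | MM _ => ~ standard th end.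

Lemma label_coarser p t q th : wf p -> del p t q -> label p t th ->
  match t with
  | MS j => coarser j q p /\ forall x, phi q (th x) = (j, x)
  | MM j => coarser j p q /\ forall x, phi p (th x) = (j, x)
  end.
Proof.
case: t => j Hp Hd L; last by split => //; apply: del_MM.
have C := del_MS Hp Hd; split => // x; apply: (@spl_inj j).
by rewrite -C L /spl /= ltnn eqxx.
Qed.

Lemma step_self p t q th : wf p -> del p t q -> label p t th ->
  match t with
  | MS _ => coarse th q /\ ~ coarse th p
  | MM _ => coarse th p /\ ~ coarse th q
  end.
Proof. by case: t => j Hp Hd L; have [] := label_coarser Hp Hd L; apply: flip_self. Qed.

Lemma step_other p t q th th' : wf p -> del p t q -> label p t th -> th' <> th ->
  coarse th' p <-> coarse th' q.
Proof.
move=> Hp Hd L ne; have Hq := del_wf Hp Hd.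
by case: t Hd L => j Hd L; have [C H] := label_coarser Hp Hd L;
  rewrite (flip_other _ C H ne).
Qed.

(** The top wire of a maximal split is a leaf of the smaller tree, hence standard. A merge with a
    standard chart would restore the cone of a caret of the tree, against reducedness. *)
Lemma max_label p t : reduced p -> is_max p t -> exists2 th, label p t th & kind t th.
Proof.
case: t => j rp [q Hd] /=; have Hp := rp.1.
  have C := del_MS Hp Hd; have Hq := del_wf Hp Hd.
  case: Hd Hq C => T0 [f1 [f2 [E1 [E2 [k1 [E3 ->]]]]]] Hq C.
  exists (sapp (addr T0 (width f1))); last by exists (addr T0 (width f1)).
  move=> x; rewrite C (@phi_eq _ _ j x) // /spl /= ?ltnn ?eqxx //.
    by rewrite -E2 size_cat /=; lia.
  by rewrite enc_addr // -E2 encf_root /= addn0.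
have jp : j < size p.2.
  by case: Hd => f1 [l [r [f2 [-> [<- _]]]]]; rewrite size_cat /=; lia.
have L : label p (MM j) (chart p j) by move=> x; apply: phi_chart.
exists (chart p j) => // -[s Es].
have [] := step_self Hp Hd L; rewrite {}Es => [[k [c Hc]] nc].
case: Hd => f1 [l [r [f2 [_ [_ Eq]]]]].
have Hs : int p.1 s by apply/negPn/negP => ni; apply: nc; apply: intN_coarse; rewrite Eq.
by apply: ((reduced_int s rp).1 Hs); exists k, c.
Qed.

(** By the criterion only the chart of the deleted transistor can cause trouble: for a merge it is
    not coarse in [q], and for a split its word is a leaf, not a caret, of the smaller tree. *)
Lemma del_reduced p t q : reduced p -> del p t q -> reduced q.
Proof.
move=> rp Hd; have Hp := rp.1; have Hq := del_wf Hp Hd.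
have [th L _] := max_label rp (ex_intro _ q Hd).
apply: int_reduced => // s Hs cq.
case: (classic (sapp s = th)) => [E|ne]; last first.
  apply: (reduced_int s rp).1; last by apply/(step_other Hp Hd L ne).
  case: t Hd {L} => j /= [].
    by move=> T0 [f1 [f2 [_ [_ [k1 [-> Eq]]]]]]; rewrite int_expt //; move: Hs; rewrite Eq => ->.
  by move=> f1 [l [r [f2 [_ [_ Eq]]]]]; move: Hs; rewrite Eq.
case: t Hd L => j Hd L; last by case: (step_self Hp Hd L) => _; rewrite -E.
have [_ H] := label_coarser Hp Hd L.
case: Hd H => T0 [f1 [f2 [_ [E2 [k1 [_ Eq]]]]]] H.
have E' : sapp s = sapp (addr T0 (width f1)).
  apply: functional_extensionality => x; apply: (@phi_inj q) => //.
  rewrite E H; symmetry; rewrite Eq; apply: phi_eq => /=; rewrite -?Eq //.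
    by rewrite -E2 size_cat /=; lia.
  by rewrite enc_addr // -E2 encf_root /= addn0.
have Es : s = addr T0 (width f1) by apply: sapp_injl => x; rewrite E'.
by move: Hs; rewrite Eq Es (negPf (int_addr k1)).
Qed.

Definition root (p : pic) (j : nat) : tree := nth Lf p.2 j.

Lemma max_root p t : is_max p t ->
  match t with
  | MS j => [/\ root p j = Lf, root p j.+1 = Lf & j.+1 < size p.2]
  | MM j => root p j <> Lf /\ j < size p.2
  end.
Proof.
case: t => j [q] /=.
  case=> T0 [f1 [f2 [E1 [<- _]]]]; rewrite /root E1 !nth_cat ltnn subnn.
  by rewrite ifF ?subSnn ?size_cat /=; last lia; split => //; lia.
case=> f1 [l [r [f2 [E1 [<- _]]]]]; rewrite /root E1 !nth_cat ltnn subnn.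
by rewrite size_cat /=; split => //; lia.
Qed.

Lemma root_eq_Lf (p : pic) j k : j < size p.2 -> (forall y, encf p.2 j y = (k, y)) ->
  exists f1 f2, [/\ p.2 = f1 ++ Lf :: f2, size f1 = j & k = width f1].
Proof.
move=> jp H; exists (take j p.2), (drop j.+1 p.2).
have E : p.2 = take j p.2 ++ nth Lf p.2 j :: drop j.+1 p.2.
  by rewrite -drop_nth // cat_take_drop.
have sz : size (take j p.2) = j by rewrite size_take jp.
rewrite sz; have H' y : encf p.2 j y =
    (width (take j p.2) + (enc (nth Lf p.2 j) y).1, (enc (nth Lf p.2 j) y).2).
  by have := encf_root (take j p.2) (nth Lf p.2 j) (drop j.+1 p.2) y; rewrite -E sz.
have [Ef kE] : nth Lf p.2 j = Lf /\ k - width (take j p.2) = 0.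
  apply: enc_const => y; have := H y; rewrite H' => -[E1 E2].
  by rewrite [LHS]surjective_pairing E2 -E1 addKn.
split => //; first by rewrite -Ef.
by have := H (fun=> true); rewrite H' Ef /= addn0 => -[].
Qed.

Lemma label_int p j s : reduced p -> label p (MS j) (sapp s) ->
  int p.1 s /\ forall b, ~~ int p.1 (s ++ [:: b]).
Proof.
move=> rp L; split=> [|b]; last first.
  apply/negP => /(reduced_int _ rp); apply; exists (j + b), [::] => x.
  by rewrite sapp_cat L.
apply/(reduced_int _ rp) => -[k [c Hc]].
have E (b : bool) : k = j + b by have := Hc (fun=> b); rewrite L => -[].
by have := E true; rewrite (E false); lia.
Qed.

(** A bare wire [j] would make the chart standard, so a nonstandard chart belongs to a merge. For a
    standard one, [s] is a caret without caret children, and its two leaves run straight down to the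
    wires [j] and [j + 1]. *)
Lemma label_max p t th : reduced p -> label p t th -> kind t th -> is_max p t.
Proof.
move=> rp; have Hp := rp.1; case: t => j L /=; last first.
  move=> ns; have jp : j < size p.2 by have := phi_lt (th (fun=> true)) Hp; rewrite L.
  case Er : (nth Lf p.2 j) => [|l r].
    case: ns; exists (addr p.1 (width (take j p.2))).
    apply: functional_extensionality => x; apply: (@enc_inj p.1).
    have sz : size (take j p.2) = j by rewrite size_take jp.
    have E : p.2 = take j p.2 ++ Lf :: drop j.+1 p.2.
      by rewrite -Er -drop_nth // cat_take_drop.
    rewrite -phi_enc // L /= enc_addr; last by rewrite Hp [X in _ < width X]E width_cat /=; lia.
    by have := encf_root (take j p.2) Lf (drop j.+1 p.2) x; rewrite -E sz /= addn0.
  exists (p.1, take j p.2 ++ l :: r :: drop j.+1 p.2), (take j p.2), l, r, (drop j.+1 p.2).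
  by rewrite -Er -drop_nth // cat_take_drop size_take jp.
move=> [s Es]; rewrite {th}Es in L.
have [Hs nb] := label_int rp L; move: Hs.
move=> /bottom_caret [T0 [k [[|b d] [kT ET Ea]]]]; last first.
  case/negP: (nb b); apply: (@int_prefix _ _ d).
  by rewrite ET int_expt // -catA /= Ea eqxx orbT.
rewrite cats0 in Ea.
have E (x : stream) : encf p.2 (j + x 0) (stl x) = (k + x 0, stl x).
  have := phi_enc (sapp s x) Hp; rewrite L /= => ->.
  by rewrite ET enc_expt // -Ea enc_addr // /spl /= ltnn eqxx.
have jp (b : bool) : j + b < size p.2.
  by have := phi_lt (sapp s (fun=> b)) Hp; rewrite L.
have E0 y : encf p.2 j y = (k, y) by have := E (scons false y); rewrite /= !addn0.
have E1 y : encf p.2 j.+1 y = (k.+1, y) by have := E (scons true y); rewrite /= !addn1.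
have := jp true; rewrite addn1 => jp1.
case: (root_eq_Lf (ltnW jp1) E0) => f1 [f2 [Ef sf kf]].
case: (root_eq_Lf jp1 E1) => g1 [g2 [Eg sg _]].
have Ef2 : f2 = Lf :: behead f2.
  have : nth Lf p.2 j.+1 = Lf by rewrite Eg nth_cat sg ltnn subnn.
  move: jp1; rewrite Ef nth_cat size_cat sf /= ifF ?subSnn; last by lia.
  by case: (f2) => [|t f] /=; [lia | move=> _ ->].
by exists (T0, f1 ++ Lf :: behead f2), T0, f1, (behead f2); rewrite -Ef2 -kf.
Qed.

Lemma spl_below k j x : j < k -> spl k (j, x) = (j, x).
Proof. by rewrite /spl /= => ->. Qed.

Lemma spl_above k j x : k < j -> spl k (j, x) = (j.+1, x).
Proof. by move=> kj; rewrite /spl /= !ifF //; lia. Qed.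

Lemma adjacent_splits p j : reduced p -> is_max p (MS j) -> is_max p (MS j.+1) -> False.
Proof.
move=> rp /(max_label rp) [th1 L1 [s1 E1]] /(max_label rp) [th2 L2 [s2 E2]].
rewrite {th1}E1 in L1; rewrite {th2}E2 in L2.
have : rcons s1 true = rcons s2 false.
  apply: sapp_injl => x; rewrite -!cats1 !sapp_cat.
  by apply: (@phi_inj p) => //; rewrite ?L1 ?L2 /= ?addn1 ?addn0 //; case: rp.
by move/(congr1 (last true)); rewrite !last_rcons.
Qed.

(** Distinct maximal transistors meet disjoint bottom wires, so deleting one only renumbers the
    wires of the other. This makes the chart an invariant of the hyperplane. *)
Lemma label_shift p t1 t2 q th : reduced p -> is_max p t1 -> del p t2 q -> t1 <> t2 ->
  label p t1 th -> label q (mt_shift t2 t1) th.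
Proof.
move=> rp m1 d2 ne L x; have m2 : is_max p t2 by exists q.
have Hp := rp.1; have := max_root m1; have := max_root m2.
case: t2 d2 ne m2 => k d2 ne m2; [have C := del_MS Hp d2 | have C := del_MM Hp d2];
  case: t1 m1 L ne => j m1 L ne /=.
- move=> _ _; have nj : j <> k by move=> E; case: ne; rewrite E.
  have nj1 : j <> k.+1 by move=> E; subst j; exact: (adjacent_splits rp m2 m1).
  have nk1 : k <> j.+1 by move=> E; subst k; exact: (adjacent_splits rp m1 m2).
  apply: (@spl_inj k); rewrite -C L; case: (ltnP j k) => jk.
    by rewrite spl_below //; case: (x 0); lia.
  rewrite spl_above; last by case: (x 0); lia.
  by congr pair; lia.
- case=> [rk rk1 _] [rj _].
  have nj : j <> k by move=> E; rewrite E in rj.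
  have nj1 : j <> k.+1 by move=> E; rewrite E in rj.
  apply: (@spl_inj k); rewrite -C L; case: (ltnP j k) => jk.
    by rewrite spl_below.
  by rewrite spl_above; [congr pair; lia | lia].
- case=> rk _ [rj rj1 _]; rewrite C L.
  have nj : j <> k by move=> E; rewrite E in rj.
  have nj1 : j.+1 <> k by move=> E; rewrite E in rj1.
  case: (ltnP j k) => jk; first by rewrite spl_below //; case: (x 0); lia.
  by rewrite spl_above ?addSn //; case: (x 0); lia.
- move=> _ _; rewrite C L.
  have nj : j <> k by move=> E; case: ne; rewrite E.
  case: (ltnP j k) => jk; first by rewrite spl_below.
  by rewrite spl_above //; lia.
Qed.

Lemma kind_shift t t' th : kind (mt_shift t' t) th = kind t th.
Proof. by case: t. Qed.

Lemma label_inj p t th th' : wf p -> label p t th -> label p t th' -> th = th'.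
Proof.
move=> Hp L L'; apply: functional_extensionality => x; apply: (@phi_inj p) => //.
by rewrite L L'.
Qed.

Lemma label_eq p t t' th : label p t th -> kind t th -> label p t' th -> kind t' th -> t = t'.
Proof.
case: t => j; case: t' => k L K L' K' //.
- by have := L' (fun=> false); rewrite L /= !addn0 => -[->].
- by have := L' (fun=> false); rewrite L => -[->].
Qed.

(** * Hyperplanes are determined by their charts *)

Lemma int_ext t t' : (forall s, int t s <-> int t' s) -> t = t'.
Proof.
elim: t t' => [|l IHl r IHr] [|l' r'] H //.
- by case: (H [::]) => _ /(_ isT).
- by case: (H [::]) => /(_ isT).
congr Nd; [apply: IHl => s; exact: (H (false :: s)) | apply: IHr => s; exact: (H (true :: s))].
Qed.

Lemma enc_ext t t' : (forall x, enc t x = enc t' x) -> t = t'.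
Proof.
elim: t t' => [|l IHl r IHr] [|l' r'] H //.
- by have [] := @enc_const (Nd l' r') 0 (fun y => esym (H y)).
- by have [] := @enc_const (Nd l r) 0 H.
have E : l = l' by apply: IHl => y; exact: (H (scons false y)).
subst l'; congr Nd; apply: IHr => y; case: (H (scons true y)).
move=> /addnI E1; rewrite -[stl _]/y => E2.
by rewrite [LHS]surjective_pairing E1 E2 -surjective_pairing.
Qed.

Lemma int_enc t s k : int t s -> ~ forall x, (enc t (sapp s x)).1 = k.
Proof.
elim: t s k => // l IHl r IHr [|b s] k /= Hs H.
  have := H (fun=> true); have := H (fun=> false) => /= E1 E2.
  by have := enc_lt l (stl (fun=> false)); rewrite E1 -E2; lia.
case: b Hs H => /= Hs H; last by apply: (IHl _ k Hs) => x; exact: (H x).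
by apply: (IHr _ (k - leaves l) Hs) => x; rewrite -(H x) addKn.
Qed.

Lemma faddr_Lf f i : i < width f -> nth Lf f (faddr f i).1 = Lf ->
  faddr f i = ((faddr f i).1, [::]).
Proof.
elim: f i => //= t f IH i itf; case: (ltnP i (leaves t)) => /= ti; first by move=> ->.
by move=> H; rewrite IH // ltn_subLR.
Qed.

Lemma faddr_next f i : i.+1 < width f -> nth Lf f (faddr f i).1 = Lf ->
  (faddr f i.+1).1 = (faddr f i).1.+1.
Proof.
elim: f i => //= t f IH i itf; case: (ltnP i (leaves t)) => /= ti H.
  subst t; case: i itf ti => //= itf _; congr S.
  by case: (f) itf => //= t' f' _; rewrite leaves_gt0.
by rewrite ifF ?subSn ?IH -?subSn ?ltn_subLR //; lia.
Qed.

Lemma bottom_label p T0 k s : reduced p ->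
  k < leaves T0 -> p.1 = expt T0 k -> addr T0 k = s ->
  root p (faddr p.2 k).1 = Lf -> root p (faddr p.2 k.+1).1 = Lf ->
  label p (MS (faddr p.2 k).1) (sapp s).
Proof.
move=> [Hp _] kT ET Es r0 r1 x; rewrite /phi ET enc_expt // -Es enc_addr //.
have kp : k.+1 < width p.2 by rewrite -Hp ET leaves_expt.
have f0 := faddr_Lf (ltnW kp) r0; have f1 := faddr_Lf kp r1.
have nx := faddr_next kp r0.
rewrite /spl /= ltnn eqxx /decf /=; case: (x 0).
  by rewrite addn1 f1 /= nx addn1.
by rewrite !addn0 {2}f0.
Qed.

(** For a well-formed picture, one more than its number of transistors: the tree has
    [leaves p.1 - 1] carets and the forest [leaves p.1 - size p.2]. *)
Definition measure (p : pic) := (leaves p.1).*2 - size p.2.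

Lemma size_width f : size f <= width f.
Proof. by elim: f => //= t f IH; have := leaves_gt0 t; lia. Qed.

Lemma del_measure p t q : wf p -> del p t q -> measure q < measure p.
Proof.
move=> Hp Hd; have Hq := del_wf Hp Hd; move: Hp Hq; rewrite /measure /wf.
have := size_width p.2; have := size_width q.2.
case: t Hd => j.
  by case=> T0 [f1 [f2 [-> [_ [k1 [-> ->]]]]]] /=; rewrite leaves_expt // !size_cat /=; lia.
by case=> f1 [l [r [f2 [-> [_ ->]]]]] /=; rewrite !size_cat /=; lia.
Qed.

Lemma root_max p j : root p j <> Lf -> is_max p (MM j).
Proof.
rewrite /root => H; case: (ltnP j (size p.2)) => jp; last by rewrite nth_default in H.
case E : (nth Lf p.2 j) H => [|l r] // _.
exists (p.1, take j p.2 ++ l :: r :: drop j.+1 p.2), (take j p.2), l, r, (drop j.+1 p.2).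
by rewrite -E -drop_nth // cat_take_drop size_take jp.
Qed.

Lemma has_max p : reduced p -> p = star \/ exists t, is_max p t.
Proof.
move=> rp; case: (classic (exists j, is_max p (MM j))) =>
  [[j mj]|no]; first by right; exists (MM j).
have R j : root p j = Lf by apply: NNPP => /root_max mj; apply: no; exists j.
case: (boolP (int p.1 [::])) => [/bottom_caret [T0 [k [d [kT ET Ea]]]]|ni].
  right; exists (MS (faddr p.2 k).1); apply: (@label_max _ _ (sapp d)) => //.
    by apply: (bottom_label rp kT ET Ea).
  by exists d.
left; case: p rp R ni {no} => [[|l r] f] //= [Hp _] R _.
move: Hp R; rewrite /wf /root /=; case: f => // t [|t' f] /=.
  by move=> _ /(_ 0) /= ->.
by have := leaves_gt0 t; have := leaves_gt0 t'; lia.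
Qed.

(** All bottom wires are bare, so every bottom caret of the tree is a maximal split; uniqueness
    leaves only the one at [s]. *)
Lemma unique_MS_int p j s : reduced p -> label p (MS j) (sapp s) ->
  (forall t, is_max p t -> t = MS j) -> forall s', int p.1 s' <-> prefix s' s.
Proof.
move=> rp L U s'; have R i : root p i = Lf by apply: NNPP => /root_max /U.
split; last by case/prefixP => d E; apply: (@int_prefix _ _ d); rewrite -E; case: (label_int rp L).
move=> /bottom_caret [T0 [k [d [kT ET Ea]]]]; apply/prefixP; exists d.
have Lk := bottom_label rp kT ET Ea (R _) (R _).
have K : kind (MS (faddr p.2 k).1) (sapp (s' ++ d)) by exists (s' ++ d).
have Ek := U _ (label_max rp Lk K); rewrite Ek in Lk.
by apply: sapp_injl => x; rewrite (label_inj rp.1 L Lk).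
Qed.

(* The right-hand side depends only on [th], so a vertex with a unique maximal
   transistor is recovered from its chart. *)
Lemma unique_MM_int p j th : reduced p -> label p (MM j) th ->
  (forall t, is_max p t -> t = MM j) -> forall s,
  int p.1 s <-> (exists x z, th x = sapp s z) /\
                ~ exists c, forall x, th (sapp c x) = sapp s x.
Proof.
move=> rp L U s; have Hp := rp.1.
have R i : i <> j -> root p i = Lf.
  by move=> ij; apply: NNPP => /root_max /U [].
have pre z k y : enc p.1 z = (k, y) -> (faddr p.2 k).1 = j -> exists x, th x = z.
  move=> E kj; exists (sapp (faddr p.2 k).2 y).
  by apply: (@phi_inj p) => //; rewrite L /phi E /decf kj.
split=> [Hs|[[x0 [z0 E0]] nc]].
  split; last first.
    case=> c Hc; apply: ((reduced_int s rp).1 Hs); exists j, c => x.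
    by rewrite -Hc L.
  case/bottom_caret: Hs => T0 [k [d [kT ET Ea]]].
  have E x : enc p.1 (sapp (s ++ d) x) = (k + x 0, stl x).
    by rewrite ET enc_expt // -Ea enc_addr // /spl /= ltnn eqxx.
  (* If neither leaf of this bottom caret belonged to tree [j], the caret would be a second maximal
     transistor. *)
  case: (classic ((faddr p.2 k).1 = j)) => [kj|kj].
    have := E (fun=> false); rewrite addn0 => /pre /(_ kj) [x Ex].
    by exists x, (sapp d (fun=> false)); rewrite -sapp_cat.
  case: (classic ((faddr p.2 k.+1).1 = j)) => [kj1|kj1].
    have := E (fun=> true); rewrite addn1 => /pre /(_ kj1) [x Ex].
    by exists x, (sapp d (fun=> true)); rewrite -sapp_cat.
  have Lk := bottom_label rp kT ET Ea (R _ kj) (R _ kj1).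
  have K : kind (MS (faddr p.2 k).1) (sapp (s ++ d)) by exists (s ++ d).
  by have := U _ (label_max rp Lk K).
apply/negPn/negP => /intN_coarse [k [c Hc]]; apply: nc; exists c => x.
apply: (@phi_inj p) => //; rewrite Hc L.
by have := Hc z0; rewrite -E0 L => -[->].
Qed.

Lemma unique_MM_forest p j : reduced p -> is_max p (MM j) ->
  (forall t, is_max p t -> t = MM j) ->
  exists F l, p.2 = nseq j Lf ++ F :: nseq l Lf.
Proof.
move=> rp /max_root [_ jp] U; exists (root p j), (size p.2 - j.+1).
have R i : i <> j -> root p i = Lf.
  by move=> ij; apply: NNPP => /root_max /U [].
apply: (@eq_from_nth _ Lf); first by rewrite size_cat /= !size_nseq; lia.
move=> i ip; rewrite nth_cat size_nseq nth_nseq; case: ltngtP => ij.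
- by apply: R; lia.
- by rewrite -[i - j]prednK ?subn_gt0 //= nth_nseq if_same; apply: R; lia.
- by rewrite ij subnn.
Qed.

Lemma width_nseq n : width (nseq n Lf) = n.
Proof. by elim: n => //= n ->. Qed.

Lemma enc_chart p j th F l x : wf p -> label p (MM j) th ->
  p.2 = nseq j Lf ++ F :: nseq l Lf ->
  enc p.1 (th x) = (j + (enc F x).1, (enc F x).2).
Proof.
move=> Hp L Ef; rewrite -phi_enc // L Ef.
have := encf_root (nseq j Lf) F (nseq l Lf) x; rewrite size_nseq => ->.
by rewrite width_nseq.
Qed.

(** The chart recovers the tree through its carets; for a merge, [enc] of the chart then recovers
    the nontrivial tree of the forest and its position. *)
Lemma unique_det p p' t t' th :
  reduced p -> label p t th -> kind t th -> (forall t2, is_max p t2 -> t2 = t) ->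
  reduced p' -> label p' t' th -> kind t' th -> (forall t2, is_max p' t2 -> t2 = t') ->
  (p, t) = (p', t').
Proof.
move=> rp L K U rp' L' K' U'; suff E : p = p'.
  by subst p'; rewrite (label_eq L K L' K').
have Hp := rp.1; have Hp' := rp'.1.
have mt := label_max rp L K; have mt' := label_max rp' L' K'.
have T_eq : (forall s, int p.1 s <-> int p'.1 s) -> p.1 = p'.1 by exact: int_ext.
case: t L K U mt => j L K U mt; case: t' L' K' U' mt' => j' L' K' U' mt' //.
  case: K => s Es; subst th.
  have {}T_eq : p.1 = p'.1.
    by apply: T_eq => s'; rewrite (unique_MS_int rp L U) (unique_MS_int rp' L' U').
  have F q i : reduced q -> (forall t2, is_max q t2 -> t2 = MS i) -> q.2 = nseq (leaves q.1) Lf.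
    move=> [Hq _] Uq; have R k : root q k = Lf by apply: NNPP => /root_max /Uq.
    have E : q.2 = nseq (size q.2) Lf.
      apply: (@eq_from_nth _ Lf); first by rewrite size_nseq.
      by move=> k _; rewrite nth_nseq if_same; exact: R.
    by rewrite Hq [in width _]E width_nseq.
  by rewrite [p]surjective_pairing [p']surjective_pairing (F _ _ rp U) (F _ _ rp' U') T_eq.
have {}T_eq : p.1 = p'.1.
  by apply: T_eq => s; rewrite (unique_MM_int rp L U) (unique_MM_int rp' L' U').
case: (unique_MM_forest rp mt U) => F [l Ef]; case: (unique_MM_forest rp' mt' U') => F' [l' Ef'].
have E x : (j + (enc F x).1, (enc F x).2) = (j' + (enc F' x).1, (enc F' x).2).
  by rewrite -(enc_chart _ Hp L Ef) -(enc_chart _ Hp' L' Ef') T_eq.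
have Ej : j = j'.
  (* The first leaf of [F] shows [j' <= j], the first leaf of [F'] shows [j <= j']. *)
  have := E (sapp (addr F 0) (fun=> true)); have := E (sapp (addr F' 0) (fun=> true)).
  by rewrite !enc_addr ?leaves_gt0 //= => -[E1 _] [E2 _]; lia.
subst j'; have EF : F = F'.
  apply: enc_ext => x; have [/addnI E1 E2] := E x.
  by rewrite [LHS]surjective_pairing E1 E2 -surjective_pairing.
subst F'; rewrite [p]surjective_pairing [p']surjective_pairing T_eq; congr pair.
rewrite Ef Ef'; congr (_ ++ _ :: nseq _ _).
by move: (Hp) (Hp'); rewrite /wf Ef Ef' T_eq !width_cat /= !width_nseq => ->; lia.
Qed.

Lemma opp_label e1 e2 th : opp e1 e2 ->
  (edge e1 /\ label e1.1 e1.2 th <-> edge e2 /\ label e2.1 e2.2 th).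
Proof.
case=> p [t1 [t2 [q2 [rp [m1 [m2 [ne [d2 [-> ->]]]]]]]]] /=.
have [th1 L1 K1] := max_label rp m1.
have L2 := label_shift rp m1 d2 ne L1; have rq := del_reduced rp d2.
have Eq : edge (q2, mt_shift t2 t1).
  by split => //=; apply: (label_max rq L2); rewrite kind_shift.
split=> [[_ L]|[_ L]]; split => //.
  by rewrite (label_inj rp.1 L L1).
by rewrite (label_inj rq.1 L L2).
Qed.

Lemma sameH_label e1 e2 th : sameH e1 e2 ->
  (edge e1 /\ label e1.1 e1.2 th <-> edge e2 /\ label e2.1 e2.2 th).
Proof.
elim=> {e1 e2} [e1 e2 /opp_label //|//|e1 e2 _ -> //|e1 e2 e3 _ -> _ -> //].
Qed.

(** Any other maximal transistor can be deleted across a square, and the process ends at the minimal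
    vertex of the hyperplane. *)
Lemma sameH_unique p t th : reduced p -> label p t th -> kind t th ->
  exists p' t', [/\ reduced p', label p' t' th, kind t' th,
    forall t2, is_max p' t2 -> t2 = t' & sameH (p, t) (p', t')].
Proof.
have [n] := ubnP (measure p); elim: n p t => // n IH p t pn rp L K.
case: (classic (exists t2, is_max p t2 /\ t2 <> t)) => [[t2 [[q d2] ne]]|no]; last first.
  exists p, t; split => //; last exact: rst_refl.
  by move=> t2 m2; apply: NNPP => ne; apply: no; exists t2.
have mt := label_max rp L K.
case: (IH q (mt_shift t2 t)) => [||||p' [t' [rp' L' K' U' S]]].
- by have := del_measure rp.1 d2; lia.
- exact: del_reduced rp d2.
- by apply: (label_shift rp mt d2) => // E; apply: ne.
- by rewrite kind_shift.
exists p', t'; split => //; apply: rst_trans S; apply: rst_step.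
by exists p, t, t2, q; do !split => //; [exists q | move=> E; apply: ne].
Qed.

Lemma label_sameH p t p' t' th :
  reduced p -> label p t th -> kind t th ->
  reduced p' -> label p' t' th -> kind t' th -> sameH (p, t) (p', t').
Proof.
move=> rp L K rp' L' K'.
have [m [s [rm Lm Km Um S]]] := sameH_unique rp L K.
have [m' [s' [rm' Lm' Km' Um' S']]] := sameH_unique rp' L' K'.
rewrite (unique_det rm Lm Km Um rm' Lm' Km' Um') in S.
exact: rst_trans S (rst_sym _ _ _ _ S').
Qed.

(* The side of the hyperplane of chart [th] not containing [star]. *)
Definition HS (th : stream -> stream) : hspace :=
  fun v => reduced v /\ ~ (coarse th v <-> coarse th star).

Lemma phi_star z : phi star z = (0, z).
Proof. by []. Qed.

Lemma coarse_star th : coarse th star <-> standard th.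
Proof.
split=> [[k [c H]]|[s ->]]; last by exists 0, s.
by exists c; apply: functional_extensionality => x; have := H x; rewrite phi_star => -[].
Qed.

(** Edges off the hyperplane preserve coarseness of [th], so vertices on different sides are not
    connected. Conversely, deletions never enter the far side, so every vertex on the near side
    descends to [star] without crossing. *)
Lemma hplus_HS p t th : edge (p, t) -> label p t th -> hplus (p, t) = HS th.
Proof.
move=> Ept L; have [rp mt] := Ept; simpl in rp, mt.
have knd u t' : edge (u, t') -> label u t' th -> kind t' th.
  move=> [ru mu] Lu; have [th' L' K'] := max_label ru mu.
  by rewrite (label_inj ru.1 Lu L').
have K := knd _ _ Ept L.
pose Pos v := ~ (coarse th v <-> coarse th star).
have PosE u t' w : edge (u, t') -> del u t' w -> label u t' th -> Pos u /\ ~ Pos w.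
  move=> Eu du Lu; have := knd _ _ Eu Lu; have := step_self Eu.1.1 du Lu.
  rewrite /Pos; case: t' {Eu du Lu} => j /= [c1 c2]; rewrite -coarse_star => k.
    by split; [tauto | move=> n; apply: n; tauto].
  by split; [tauto | move=> n; apply: n; tauto].
have PosM u t' w : edge (u, t') -> del u t' w -> Pos w -> Pos u.
  move=> Eu du Pw; have [th' L' K'] := max_label Eu.1 Eu.2.
  case: (classic (th = th')) => [E|ne]; last by rewrite /Pos (step_other Eu.1.1 du L' ne).
  by rewrite -E in L'; case: (PosE _ _ _ Eu du L').
have cross u w : adj_off (p, t) u w -> (Pos u <-> Pos w).
  case=> t' [Eu [du nS]]; have [th' L' K'] := max_label Eu.1 Eu.2.
  suff ne : th <> th' by rewrite /Pos (step_other Eu.1.1 du L' ne).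
  by move=> E; apply: nS; rewrite -E in L' K'; apply: (label_sameH Eu.1 L' K' rp L K).
have down v : reduced v -> ~ Pos v -> rst (adj_off (p, t)) star v.
  have [n] := ubnP (measure v); elim: n v => // n IH v vn rv nP.
  case: (has_max rv) => [->|[t' [w dw]]]; first exact: rst_refl.
  have Ev : edge (v, t') by split => //; exists w.
  have nPw : ~ Pos w by move=> /(PosM _ _ _ Ev dw).
  apply: rst_trans (IH w _ _ nPw) _.
  - by have := del_measure rv.1 dw; lia.
  - exact: del_reduced rv dw.
  apply/rst_sym/rst_step; exists t'; split => //; split => // S.
  have [_ H] := sameH_label th S.
  by have [_ Lv] := H (conj Ept L); case: (PosE _ _ _ Ev dw Lv).
have side v w : rst (adj_off (p, t)) v w -> (Pos v <-> Pos w).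
  by elim=> {v w} [v w /cross //|//|v w _ -> //|v w z _ -> _ -> //].
apply: functional_extensionality => v; apply: propositional_extensionality.
split=> [[rv nc]|[rv Pv]]; split => //.
  by apply: NNPP => nP; apply: nc; apply: down.
by move/side => H; have := H.2 Pv; apply.
Qed.

(** * Half-spaces of words, and the action of F *)

Definition vert (t : tree) : pic := (t, nseq (leaves t) Lf).

Lemma wf_vert t : wf (vert t).
Proof. by rewrite /wf /= width_nseq. Qed.

Lemma phi_vert t z : phi (vert t) z = enc t z.
Proof.
rewrite /phi /decf /= [RHS]surjective_pairing.
suff F n i : i < n -> faddr (nseq n Lf) i = (i, [::]) by rewrite F ?enc_lt.
by elim: n i => // n IH [|i] //= i_n; rewrite subSS subn0 IH.
Qed.

Lemma reduced_vert t : reduced (vert t).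
Proof.
apply: int_reduced => [|s Hs [k [c Hc]]]; first exact: wf_vert.
by apply: (int_enc (k := k) Hs) => x; rewrite -phi_vert Hc.
Qed.

Lemma root_vert t j : root (vert t) j = Lf.
Proof. by rewrite /root /= nth_nseq if_same. Qed.

Lemma int_path_tree s s' : int (path_tree s) s' = prefix s' s.
Proof. by elim: s s' => [|[] s IH] [|[] s'] //=; rewrite ?IH; case: s'. Qed.

(** In the path tree the only caret without caret children is [s], and bare bottom wires exclude
    merges. *)
Lemma vtree_max s : exists t, [/\ is_max (vtree s) t, label (vtree s) t (sapp s) &
  forall t', is_max (vtree s) t' -> t' = t].
Proof.
have rs : reduced (vtree s) := reduced_vert _.
have P t : is_max (vtree s) t -> label (vtree s) t (sapp s) /\ kind t (sapp s).
  move=> mt; have [th L K] := max_label rs mt.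
  case: t mt L K => j mt L K; last by case: (max_root mt); rewrite root_vert.
  case: K => s' Es; subst th; suff Es : s' = s by subst s'; split => //; exists s.
  case: (label_int rs L); rewrite /= int_path_tree => /prefixP [[|b d] Ed] nb.
    by rewrite Ed cats0.
  case/negP: (nb b); rewrite int_path_tree; apply/prefixP; exists d.
  by rewrite Ed -catA.
have [t mt] : exists t, is_max (vtree s) t.
  case: (has_max rs) => // E; suff : int star.1 [::] by [].
  by rewrite -E /= int_path_tree prefix0s.
have [L K] := P _ mt; exists t; split => // t' /P [L' K'].
exact: label_eq L' K' L K.
Qed.

Lemma P_S_HS X : P_S X = fun S => exists2 s, X s & S = HS (sapp s).
Proof.
apply: functional_extensionality => S; apply: propositional_extensionality.
have rs s : reduced (vtree s) := reduced_vert _.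
split=> [[s [Xs [t [mt [U ->]]]]]|[s Xs ->]]; have [t0 [m0 L0 U0]] := vtree_max s.
  by exists s => //; rewrite (U0 _ mt); exact: hplus_HS (conj (rs s) m0) L0.
by exists s; split => //; exists t0; rewrite (hplus_HS (conj (rs s) m0) L0).
Qed.

Lemma HS_int s v : HS (sapp s) v <-> reduced v /\ int v.1 s.
Proof.
split=> -[rv H]; split => //.
  apply/(reduced_int _ rv) => c; apply: H; split => // _.
  by apply/coarse_star; exists s.
move/(reduced_int _ rv): H => nc H; apply: nc; apply/H/coarse_star; by exists s.
Qed.

Definition charted (th : stream -> stream) : Prop :=
  exists w j, wf w /\ forall x, phi w (th x) = (j, x).

Lemma charted_sapp s : charted (sapp s).
Proof.
have [t [[q d] L _]] := vtree_max s.
have Hp := wf_vert (path_tree s); have Hq := del_wf Hp d.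
case: t d L => j d L; have [_ H] := label_coarser Hp d L.
  by exists q, j.
by exists (vtree s), j.
Qed.

(** A nonstandard chart stays a chart when the picture is reduced, and its wire then ends in a
    merge, which gives an edge; a standard one belongs to an edge at [vtree s]. *)
Lemma positive_HS S : positive S <-> exists2 th, charted th & S = HS th.
Proof.
split=> [[[p t] [E ->]]|[th [w [j [Hw Hj]]] ->]].
  have [rp mt] := E; simpl in rp, mt.
  have [th L K] := max_label rp mt; exists th; last exact: hplus_HS.
  case: mt L => q d L; have Hq := del_wf rp.1 d.
  by case: t {E K} d L => j d L; have [_ H] := label_coarser rp.1 d L;
    [exists q, j | exists p, j; case: rp].
case: (classic (standard th)) => [[s ->]|ns].
  have [t [mt L _]] := vtree_max s; have Es : edge (vtree s, t) by split => //; exact: reduced_vert.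
  by exists (vtree s, t); rewrite (hplus_HS Es L).
have [q rq wq] := wf_reduce Hw; have [Ephi _] := dequiv_phi wq.
have L : label q (MM j) th by move=> x; rewrite Ephi.
have Eq : edge (q, MM j) by split => //; apply: label_max L _.
by exists (q, MM j); rewrite (hplus_HS Eq L).
Qed.

Definition phiF (g : pic) (z : stream) : stream := (phi g z).2.

Lemma phiF_phi g z : inF g -> phi g z = (0, phiF g z).
Proof.
move=> [[Hg _] s1]; rewrite [LHS]surjective_pairing; congr pair.
by have := phi_lt z Hg; rewrite s1; case: (phi g z).1.
Qed.

Lemma phi_pair A B z : leaves A = leaves B ->
  phi (A, [:: B]) z = (0, sapp (addr B (enc A z).1) (enc A z).2).
Proof. by move=> AB; rewrite /phi /decf /= -AB enc_lt. Qed.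

(** Concatenation on top is precomposition: the middle tree [B], read upwards in [g] and downwards
    in [v], cancels. *)
Lemma act_phi g v w : inF g -> act g v w -> reduced v ->
  forall z, phi w z = phi v (phiF g z).
Proof.
move=> Fg [rw [A [B [Fo [gA [vB AFw]]]]]] rv z.
have [Eg _] := dequiv_phi gA; have [Ev _] := dequiv_phi vB; have [Ew _] := dequiv_phi AFw.
have AB : leaves A = leaves B.
  by have := (dequiv_wf gA).1 Fg.1.1; rewrite /wf /= addn0.
have Ez := phiF_phi z Fg; rewrite -Eg phi_pair // in Ez.
case: Ez => Ez; rewrite -Ev Ew /phi /=; by rewrite -Ez enc_addr -?AB ?enc_lt.
Qed.

Fixpoint join (t u : tree) : tree :=
  match t, u with
  | Lf, _ => u
  | _, Lf => t
  | Nd l r, Nd l' r' => Nd (join l l') (join r r')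
  end.

Lemma int_join t u s : int (join t u) s = int t s || int u s.
Proof.
elim: t u s => [|l IHl r IHr] [|l' r'] s //=; first by rewrite orbF.
by case: s => [|[] s] //=; rewrite ?IHl ?IHr.
Qed.

Lemma joinC t u : join t u = join u t.
Proof. by apply: int_ext => s; rewrite !int_join orbC. Qed.

Lemma leaves_join t u : leaves t <= leaves (join t u).
Proof.
elim: t u => [|l IHl r IHr] [|l' r'] //=; first by have := leaves_gt0 l'; lia.
exact: leq_add.
Qed.

Lemma join_expt t u : join t u = t \/ exists k, k < leaves t /\ join (expt t k) u = join t u.
Proof.
elim: t u => [|l IHl r IHr] [|l' r'];
  [by left | by right; exists 0 | by left |].
move=> /=; case: (IHl l') => [El|[k [kl E]]].
  case: (IHr r') => [Er|[k [kr E]]]; first by left; rewrite El Er.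
  right; exists (leaves l + k); rewrite ltn_add2l; split => //.
  have -> : (leaves l + k < leaves l) = false by lia.
  by rewrite addKn /= E.
by right; exists k; rewrite kl /= E; split => //; lia.
Qed.

Lemma dequiv_join p t : wf p -> exists f, dequiv p (join p.1 t, f).
Proof.
have [n] := ubnP (leaves (join p.1 t) - leaves p.1); elim: n p => // n IH p pn Hp.
case: (join_expt p.1 t) => [E|[k [kp E]]].
  by exists p.2; rewrite E -surjective_pairing; apply: rst_refl.
have St : exp_step p (expand p k) by split => //; exists k.
case: (IH (expand p k)) => [||f D]; last first.
- by exists f; apply: rst_trans (rst_step _ _ _ _ St) _; rewrite -E.
- exact: wf_expand.
have := leaves_join (expt p.1 k) t; rewrite /= E leaves_expt //; lia.
Qed.

(** Once [g] and [w] are expanded to a common top tree [A], the preimage consists of the lower tree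
    [B] of [g] above the forest of [w]. *)
Lemma act_exists g w : inF g -> reduced w -> exists2 v, reduced v & act g v w.
Proof.
move=> Fg rw; have [fg Dg] := dequiv_join w.1 Fg.1.1; have [fw Dw] := dequiv_join g.1 rw.1.
rewrite joinC in Dw; set A := join _ _ in Dg Dw.
have [B E] : exists B, fg = [:: B].
  have [_] := dequiv_phi Dg; rewrite Fg.2 /=.
  by case: (fg) => [|B [|? ?]] // _; exists B.
subst fg; have Wg := (dequiv_wf Dg).1 Fg.1.1; have Ww := (dequiv_wf Dw).1 rw.1.
have HB : wf (B, fw) by move: Wg Ww; rewrite /wf /= addn0 => -> ->.
have [v rv Dv] := wf_reduce HB; exists v => //; split => //.
by exists A, B, fw; split => //; split; exact: rst_sym.
Qed.

Lemma phiF_inj g z z' : inF g -> phiF g z = phiF g z' -> z = z'.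
Proof. by move=> Fg E; apply: (@phi_inj g); [case: Fg => -[] | rewrite !phiF_phi // E]. Qed.

Lemma phiF_surj g y : inF g -> exists z, phiF g z = y.
Proof.
move=> Fg; have [z Hz] := @phi_surj g 0 y Fg.1.1 (eq_leq (esym Fg.2)).
by exists z; rewrite /phiF Hz.
Qed.

Lemma act_coarse g v w th th' : inF g -> act g v w -> reduced v ->
  (forall x, phiF g (th' x) = th x) -> coarse th' w <-> coarse th v.
Proof.
by move=> Fg a rv E; split=> -[k [c H]]; exists k, c => x; have := H x;
  rewrite (act_phi Fg a rv) E.
Qed.

(** By [act_phi], coarseness of [th] is carried to coarseness of [th']. The hypothesis on
    standardness keeps [star] on the matching side, so that a positive half-space goes to a positive
    one. *)
Lemma gimg_HS g th th' : inF g -> (forall x, phiF g (th' x) = th x) ->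
  (standard th <-> standard th') -> gimg g (HS th) = HS th'.
Proof.
move=> Fg E st; apply: functional_extensionality => w; apply: propositional_extensionality.
split=> [[v [[rv H] a]]|[rw H]].
  have [rw _] := a; split => //.
  by rewrite (act_coarse Fg a rv E) coarse_star -st -coarse_star.
have [v rv a] := act_exists Fg rw; exists v; split => //; split => //.
by move: H; rewrite (act_coarse Fg a rv E) !coarse_star st.
Qed.

Lemma F_of_trees A B : leaves A = leaves B ->
  exists2 g, inF g & forall z, phiF g z = sapp (addr B (enc A z).1) (enc A z).2.
Proof.
move=> AB; have [|g rg D] := @wf_reduce (A, [:: B]); first by rewrite /wf /= addn0.
have [E1 E2] := dequiv_phi D; exists g => [|z]; first by split.
by rewrite /phiF E1 phi_pair.
Qed.

Lemma F_inv g : inF g -> exists2 h, inF h & forall z, phiF h (phiF g z) = z.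
Proof.
move=> Fg; have [B E] : exists B, g.2 = [:: B].
  by move: Fg.2; case: (g.2) => [|B [|? ?]] // _; exists B.
have W : leaves g.1 = leaves B by have := Fg.1.1; rewrite /wf E /= addn0.
have [h Fh Hh] := F_of_trees (esym W); exists h => // z.
have : phiF g z = sapp (addr B (enc g.1 z).1) (enc g.1 z).2.
  by rewrite /phiF (surjective_pairing g) E phi_pair.
by move=> ->; rewrite Hh enc_addr ?addr_enc // -W enc_lt.
Qed.

Lemma charted_pull g th th' : inF g -> (forall x, phiF g (th' x) = th x) ->
  charted th -> charted th'.
Proof.
move=> Fg E [w [j [Hw H]]]; have [w0 rw0 D] := wf_reduce Hw.
have [Ew _] := dequiv_phi D; have [h Fh hK] := F_inv Fg.
have [v rv a] := act_exists Fh rw0; exists v, j; split; first by case: rv.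
by move=> x; rewrite -(hK (th' x)) -(act_phi Fh a rv) E Ew.
Qed.

Lemma HS_inj s s' : HS (sapp s) = HS (sapp s') -> s = s'.
Proof.
have P a b : HS (sapp a) = HS (sapp b) -> prefix b a.
  move=> E; have : HS (sapp a) (vtree a).
    apply/HS_int; split; [exact: reduced_vert | by rewrite int_path_tree prefix_refl].
  by rewrite E => /HS_int [_]; rewrite int_path_tree.
move=> E; have /prefixP [d Ed] := P _ _ (esym E); have := P _ _ E.
by rewrite Ed => /size_prefix; rewrite size_cat; case: d Ed => [|b d] /=; rewrite ?cats0 //; lia.
Qed.

Lemma hle_prefix s s' : hle (HS (sapp s)) (HS (sapp s')) <-> prefix s s'.
Proof.
split=> [H|/prefixP [d ->] v /HS_int [rv Hv]]; last first.
  by apply/HS_int; split => //; apply: int_prefix Hv.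
have /H /HS_int [_] : HS (sapp s') (vtree s').
  apply/HS_int; split; [exact: reduced_vert | by rewrite int_path_tree prefix_refl].
by rewrite int_path_tree.
Qed.

(** All bottom wires of [vtree s] and [star] have standard charts, so a nonstandard chart does not
    separate these two vertices, while [vtree s] lies in [HS (sapp s)]. *)
Lemma below_standard th s : hle (HS th) (HS (sapp s)) ->
  exists2 s', th = sapp s' & prefix s' s.
Proof.
move=> H; have := H (vtree s) _; case.
  apply/HS_int; split; [exact: reduced_vert | by rewrite int_path_tree prefix_refl].
move=> _ nc; suff [s' E] : standard th by exists s' => //; apply/hle_prefix; rewrite -E.
apply: NNPP => ns; apply: nc; split=> [[k [c Hc]]|/coarse_star //].
case: ns; exists (addr (path_tree s) k ++ c); apply: functional_extensionality => x.
by rewrite -(addr_enc (path_tree s) (th x)) -phi_vert Hc sapp_cat.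
Qed.

(** * Profiles given by sets of words *)

Definition F_stable (X : seq bool -> Prop) := forall g s s', inF g ->
  (forall x, phiF g (sapp s x) = sapp s' x) -> X s <-> X s'.

Lemma int_size t s : int t s -> size s < leaves t.
Proof.
elim: t s => // l IHl r IHr [|b s] /=; have := leaves_gt0 l; have := leaves_gt0 r; first by lia.
by case: b => lr ll => [/IHr|/IHl]; lia.
Qed.

Lemma P_S_profile X :
  (exists s, X s) -> (forall s s', prefix s s' -> X s' -> X s) ->
  (forall s, X s -> exists b, forall n, X (s ++ nseq n b)) ->
  profile (P_S X).
Proof.
move=> [s0 X0] pX ext; rewrite P_S_HS; split.
- by exists (HS (sapp s0)), s0.
- move=> _ [s _ ->]; apply/positive_HS; exists (sapp s) => //; exact: charted_sapp.
- move=> l Hl; suff [t Ht] : exists t, forall S, List.In S l -> S (vert t).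
    by exists (vert t); split => //; exact: reduced_vert.
  elim: l Hl => [|S l IH] Hl; first by exists Lf.
  case: IH => [S' Sl|t Ht]; first by apply: Hl; right.
  case: (Hl S); first by left.
  move=> s _ ES; exists (join t (path_tree s)) => S' [<-|S'l].
    rewrite ES; apply/HS_int; split; first exact: reduced_vert.
    by rewrite /= int_join int_path_tree prefix_refl orbT.
  have := Ht _ S'l; case: (Hl S'); first by right.
  move=> s' _ -> /HS_int [_ Hs']; apply/HS_int; split; first exact: reduced_vert.
  by rewrite /= int_join Hs'.
- move=> _ [s Xs ->]; have [b Xb] := ext _ Xs; exists (HS (sapp (s ++ [:: b]))).
  split; first by exists (s ++ [:: b]) => //; exact: (Xb 1).
  rewrite !hle_prefix prefix_prefix; split => //.
  by move/size_prefix; rewrite size_cat /=; lia.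
move=> _ S' [s Xs ->] /positive_HS [th _ ->] /below_standard [s' -> ps].
by exists s' => //; apply: pX Xs.
Qed.

(** An element of F moves a word to a word once the word reaches a leaf of its tree. Such words are
    cofinal, since a constant run inside [X] reaches a leaf from any word of [X]. *)
Lemma P_S_fixed X :
  profile (P_S X) -> F_stable X -> 
  (forall s, X s -> exists b, forall n, X (s ++ nseq n b)) ->
  fixed_by_F (P_S X).
Proof.
move=> pX st ext g Fg.
have [h Fh hK] := F_inv Fg.
have gK z : phiF g (phiF h z) = z.
  by have [y <-] := phiF_surj z Fg; rewrite hK.
have far k s : inF k -> X s -> exists s', [/\ X s', prefix s s' &
    exists s'', forall x, phiF k (sapp s'' x) = sapp s' x].
  move=> Fk Xs; have [b Xb] := ext _ Xs.
  have [k' Fk' kK] := F_inv Fk.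
  (* The number of leaves exceeds the length of every caret address, so [s'] is not a caret of
     [k'.1]. *)
  pose s' := s ++ nseq (leaves k'.1) b; exists s'.
  split; [exact: Xb | exact: prefix_prefix |].
  have /intN_coarse [j [c Hc]] : ~~ int k'.1 s'.
    by apply/negP => /int_size; rewrite /s' size_cat size_nseq; lia.
  exists c => x; have [y Ey] := phiF_surj (sapp s' x) Fk.
  by rewrite -Ey; congr (phiF k _); rewrite -(kK y) Ey /phiF Hc.
exists (fun S => exists s s', [/\ X s, S = HS (sapp s) & forall x, phiF g (sapp s' x) = sapp s x]).
have img s s' : (forall x, phiF g (sapp s' x) = sapp s x) -> gimg g (HS (sapp s)) = HS (sapp s').
  by move=> E; apply: gimg_HS => //; split=> _; [exists s' | exists s].
have pos s : positive (HS (sapp s)).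
  by apply/positive_HS; exists (sapp s) => //; exact: charted_sapp.
split; [|split; [|split; [|split; [exact: pX|split]]]].
- by move=> S [s [s' [Xs -> _]]]; rewrite P_S_HS; exists s.
- rewrite {1}P_S_HS => _ [s Xs ->]; have [s' [Xs' ps [s'' E]]] := far g s Fg Xs.
  by exists (HS (sapp s')); split; [exists s', s'' | apply/hle_prefix].
- by move=> _ [s [s' [_ -> E]]]; rewrite (img _ _ E).
- move=> _ [s [s' [Xs -> E]]]; rewrite (img _ _ E) P_S_HS; exists s' => //.
  exact/(st _ _ _ Fg E).
rewrite {1}P_S_HS => _ [s Xs ->]; have [s' [Xs' ps [s'' E]]] := far h s Fh Xs.
have E' x : phiF g (sapp s' x) = sapp s'' x by rewrite -E gK.
exists (HS (sapp s'')); split; last by rewrite (img _ _ E'); apply/hle_prefix.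
exists s'', s'; split => //; exact/(st _ _ _ Fg E').
Qed.

(** * Fixed profiles *)

Lemma P_S_sub X X' : P_S X = P_S X' -> forall s, X s -> X' s.
Proof.
move=> E s Xs; have : P_S X (HS (sapp s)) by rewrite P_S_HS; exists s.
by rewrite E P_S_HS => -[s' Xs' /HS_inj ->].
Qed.

Lemma P_S_ext X X' : (forall s, X s <-> X' s) -> P_S X = P_S X'.
Proof.
move=> E; congr P_S; apply: functional_extensionality => s.
exact: propositional_extensionality.
Qed.

(** * The four fixed profiles *)

Lemma enc_cst t b : enc t (fun=> b) = (if b then (leaves t).-1 else 0, fun=> b).
Proof.
elim: t => [|l IHl r IHr] /=; first by case: b.
case: b IHl IHr => IHl IHr; last exact: IHl.
by rewrite [enc r _]IHr /=; congr pair; have := leaves_gt0 r; lia.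
Qed.

(** The first leaf goes to the first and the last to the last, so both ends of the interval are
    fixed. *)
Lemma phiF_cst g b : inF g -> phiF g (fun=> b) = fun=> b.
Proof.
move=> Fg; have [B E] : exists B, g.2 = [:: B].
  by move: Fg.2; case: (g.2) => [|B [|? ?]] // _; exists B.
have W : leaves g.1 = leaves B by have := Fg.1.1; rewrite /wf E /= addn0.
rewrite /phiF (surjective_pairing g) E phi_pair //= enc_cst W.
by have := addr_enc B (fun=> b); rewrite enc_cst.
Qed.

Definition constant_word (b : bool) (s : seq bool) : Prop := exists k, s = nseq k b.

(** Turns constancy into a fixed-point property, which elements of F respect because they fix the
    constant streams. *)
Lemma constant_wordP b s : constant_word b s <-> sapp s (fun=> b) = fun=> b.
Proof.
split=> [[k ->]|].
  by elim: k => //= k ->; apply: functional_extensionality => -[].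
elim: s => [_|c s IH E]; first by exists 0.
have Ec : c = b := congr1 (fun z : stream => z 0) E.
by case: IH => [|k ->]; [exact: (congr1 stl E) | exists k.+1; rewrite Ec].
Qed.

Lemma F_stable_constant b : F_stable (constant_word b).
Proof.
move=> g s s' Fg E; rewrite !constant_wordP -E; split=> [->|H]; first exact: phiF_cst.
by apply: (phiF_inj Fg); rewrite H phiF_cst.
Qed.

Lemma constant_prefix b s s' : prefix s s' -> constant_word b s' -> constant_word b s.
Proof.
move=> /prefixP [d ->] /constant_wordP E; apply/constant_wordP.
move: E; rewrite sapp_cat; elim: s => [|c s IH] //= E.
have Ec : c = b := congr1 (fun z : stream => z 0) E.
rewrite Ec IH; first by apply: functional_extensionality => -[].
exact: (congr1 stl E).
Qed.

Lemma constant_ext b s n : constant_word b s -> constant_word b (s ++ nseq n b).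
Proof. by move=> [k ->]; exists (k + n); rewrite nseqD. Qed.

Lemma P_S_fixed_profile X :
  (exists s, X s) -> (forall s s', prefix s s' -> X s' -> X s) ->
  (forall s, X s -> exists b, forall n, X (s ++ nseq n b)) -> F_stable X ->
  profile (P_S X) /\ fixed_by_F (P_S X).
Proof.
move=> X0 pX ext st; have pr := P_S_profile X0 pX ext.
by split => //; apply: P_S_fixed.
Qed.

Lemma Delta_L_E : Delta_L = P_S (constant_word false). Proof. by []. Qed.
Lemma Delta_R_E : Delta_R = P_S (constant_word true). Proof. by []. Qed.

Lemma Delta_LR_E : Delta_LR = P_S (fun s => constant_word false s \/ constant_word true s).
Proof.
apply: P_S_ext => s; split=> [[k [H|H]]|[[k H]|[k H]]].
- by left; exists k.
- by right; exists k.
- by exists k; left.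
- by exists k; right.
Qed.

Lemma P_S_constant_fixed_profile b :
  profile (P_S (constant_word b)) /\ fixed_by_F (P_S (constant_word b)).
Proof.
apply: P_S_fixed_profile; first by exists [::], 0.
- by move=> s s'; apply: constant_prefix.
- by move=> s H; exists b => n; apply: constant_ext.
- exact: F_stable_constant.
Qed.

Lemma Delta_LR_fixed_profile : profile Delta_LR /\ fixed_by_F Delta_LR.
Proof.
rewrite Delta_LR_E; apply: P_S_fixed_profile; first by exists [::]; left; exists 0.
- by move=> s s' p [H|H]; [left|right]; apply: constant_prefix H.
- by move=> s [H|H]; [exists false => n; left | exists true => n; right]; apply: constant_ext.
- by move=> g s s' Fg E; rewrite !(F_stable_constant _ Fg E).
Qed.

Lemma Delta_inf_fixed_profile : profile Delta_inf /\ fixed_by_F Delta_inf.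
Proof. by apply: P_S_fixed_profile => //; [exists [::] | exists false]. Qed.

Lemma spl_at k b s x : spl k (k, sapp (b :: s) x) = (k + b, sapp s x).
Proof. by rewrite /spl /= ltnn eqxx. Qed.

(* A copy of a standard generator of F, supported on the cone of [a]. *)
Lemma local_F a : exists2 g, inF g &
  [/\ forall x, phiF g (sapp (a ++ [:: false; false]) x) = sapp (a ++ [:: false]) x,
      forall x, phiF g (sapp (a ++ [:: false; true]) x) = sapp (a ++ [:: true; false]) x &
      forall x, phiF g (sapp (a ++ [:: true]) x) = sapp (a ++ [:: true; true]) x].
Proof.
have : int (path_tree a) a by rewrite int_path_tree prefix_refl.
move=> /bottom_caret [t [k [d [kt ET Ea]]]].
have d0 : d = [::].
  have : prefix (a ++ d) a by rewrite -int_path_tree ET int_expt // Ea eqxx orbT.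
  by move/size_prefix; rewrite size_cat; case: (d) => //= *; lia.
rewrite {}d0 cats0 in Ea; have L := leaves_expt kt.
(* The two trees with three leaves, grafted at the leaf [k] of address [a]: the leaves [a00], [a01],
   [a1] go to [a0], [a10], [a11]. *)
have [g Fg Hg] : exists2 g, inF g & forall z,
    phiF g z = sapp (addr (expt (expt t k) k.+1) (enc (expt (expt t k) k) z).1)
                    (enc (expt (expt t k) k) z).2.
  by apply: F_of_trees; rewrite !leaves_expt ?L //; lia.
exists g => //.
have H z z' : spl k (spl k (k, z)) = spl k.+1 (spl k (k, z')) ->
    phiF g (sapp a z) = sapp a z'.
  move=> E; rewrite Hg; set q := enc _ _.
  suff -> : q = enc (expt (expt t k) k.+1) (sapp a z') by rewrite addr_enc.
  by rewrite /q !enc_expt ?L //; try lia; rewrite -Ea !enc_addr.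
split=> x; rewrite !sapp_cat; apply: H; rewrite [sapp]lock /= -lock !(spl_at, addn0, addn1).
- by rewrite spl_below.
- by [].
- by rewrite spl_above.
Qed.

(** * Classification of the fixed profiles *)

Section FixedProfile.

Variable D : hspace -> Prop.
Hypotheses (pD : profile D) (fD : fixed_by_F D).

(** Some member of the cofinal family lies above [S]; its translate is in [D] and above that of [S],
    so downward closure applies. *)
Lemma fixed_gimg g S : inF g -> D S -> positive (gimg g S) -> D (gimg g S).
Proof.
move=> Fg DS pS; case: (fD Fg) => H' [_ [cof [_ [_ [img _]]]]].
have [S' [HS' le]] := cof _ DS; case: pD => _ _ _ _; apply; [exact: (img _ HS') | by [] |].
by move=> w [v [Sv a]]; exists v; split => //; apply: le.
Qed.

(** For a nonstandard chart the half-space is the set of vertices where the chart is coarse. A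
    translate coarse at none of these vertices also lies in [D], against finite intersections. *)
Lemma fixed_standard th : charted th -> D (HS th) -> standard th.
Proof.
move=> cth Dth; apply: NNPP => ns; have [w [j [Hw H]]] := cth.
(* The cone of [a], a leaf of the tree of [w] met by the image of [th], lies entirely in that image;
   [b] is the corresponding word on wire [j]. *)
pose i := (enc w.1 (th (fun=> false))).1; pose a := addr w.1 i.
have il : i < leaves w.1 := enc_lt _ _.
have [b Hb] : exists b, forall y, th (sapp b y) = sapp a y.
  have Ha y : phi w (sapp a y) = ((faddr w.2 i).1, sapp (faddr w.2 i).2 y).
    by rewrite /phi enc_addr.
  have Ej : j = (faddr w.2 i).1.
    have := Ha (enc w.1 (th (fun=> false))).2; rewrite addr_enc H.
    by case.
  exists (faddr w.2 i).2 => y; apply: (@phi_inj w) => //.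
  by rewrite Ha H -Ej.
(* [g] distorts [th] on part of its image: no node can lie above both [th] and
   [th'], because their slopes differ by different factors there. *)
have [g Fg [g00 _ g1]] := local_F a; have [h Fh hK] := F_inv Fg.
pose th' x := phiF h (th x).
have E x : phiF g (th' x) = th x.
  by rewrite /th'; have [y <-] := phiF_surj (th x) Fg; rewrite hK.
have E0 x : th' (sapp (b ++ [:: false]) x) = sapp (a ++ [:: false; false]) x.
  by rewrite /th' sapp_cat Hb -sapp_cat -g00 hK.
have E1 x : th' (sapp (b ++ [:: true; true]) x) = sapp (a ++ [:: true]) x.
  by rewrite /th' sapp_cat Hb -sapp_cat -g1 hK.
have ns' : ~ standard th'.
  (* The two cones would give [size s + size b] as both [size a + 1] and [size a - 1]. *)
  case=> s Es; have /sapp_injl/(congr1 size) X0 : forall x,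
    sapp (s ++ b ++ [:: false]) x = sapp (a ++ [:: false; false]) x.
    by move=> x; rewrite sapp_cat -Es E0.
  have /sapp_injl/(congr1 size) : forall x,
    sapp (s ++ b ++ [:: true; true]) x = sapp (a ++ [:: true]) x.
    by move=> x; rewrite sapp_cat -Es E1.
  by move: X0; rewrite !size_cat /=; lia.
have img : gimg g (HS th) = HS th' by apply: gimg_HS => //; split.
have Dth' : D (HS th').
  rewrite -img; apply: fixed_gimg => //; rewrite img; apply/positive_HS.
  by exists th' => //; apply: charted_pull Fg E cth.
case: (pD) => _ _ /(_ [:: HS th; HS th']) [S /= [<-|[<-|[]]] //|v [rv Hv]] _ _.
have coarse_of t : ~ standard t -> HS t v -> coarse t v.
  by move=> nt [_ nc]; apply: NNPP => n; apply: nc; split => // /coarse_star.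
have [k [c Hc]] := coarse_of _ ns (Hv _ (or_introl erefl)).
have [k' [c' Hc']] := coarse_of _ ns' (Hv _ (or_intror (or_introl erefl))).
have snd_eq (m n : nat) (u z : stream) : (m, u) = (n, z) -> u = z by case.
have Ha y : phi v (sapp a y) = (k, sapp (c ++ b) y) by rewrite -Hb Hc sapp_cat.
(* Here [size c'] comes out as [size c + 1], and on the other cone as [size c - 1]. *)
have /sapp_injl/(congr1 size) X0 : forall x,
    sapp (c' ++ b ++ [:: false]) x = sapp (c ++ b ++ [:: false; false]) x.
  move=> x; have := Hc' (sapp (b ++ [:: false]) x).
  by rewrite E0 (sapp_cat a) Ha => /snd_eq; rewrite -!sapp_cat -catA => ->.
have /sapp_injl/(congr1 size) : forall x,
    sapp (c' ++ b ++ [:: true; true]) x = sapp (c ++ b ++ [:: true]) x.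
  move=> x; have := Hc' (sapp (b ++ [:: true; true]) x).
  by rewrite E1 (sapp_cat a) Ha => /snd_eq; rewrite -!sapp_cat -catA => ->.
by move: X0; rewrite !size_cat /=; lia.
Qed.

Let Y s := D (HS (sapp s)).

Lemma fixed_P_S : D = P_S Y.
Proof.
rewrite P_S_HS; apply: functional_extensionality => S; apply: propositional_extensionality.
split=> [DS|[s Ys ->] //]; case: (pD) => _ pos _ _ _.
have /positive_HS [th cth ES] := pos _ DS; rewrite ES in DS *.
by have [s Es] := fixed_standard cth DS; exists s; rewrite /Y -Es.
Qed.

Lemma positive_sapp s : positive (HS (sapp s)).
Proof. by apply/positive_HS; exists (sapp s) => //; exact: charted_sapp. Qed.

Lemma Y_prefix s s' : prefix s s' -> Y s' -> Y s.
Proof.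
move=> p Ys; case: (pD) => _ _ _ _ down; apply: down Ys _ _; first exact: positive_sapp.
exact/hle_prefix.
Qed.

Lemma Y_nil : Y [::].
Proof.
case: (pD) => -[S DS] _ _ _ _; move: DS; rewrite fixed_P_S P_S_HS => -[s Ys _].
by apply: Y_prefix Ys; exact: prefix0s.
Qed.

Lemma Y_next s : Y s -> exists b, Y (s ++ [:: b]).
Proof.
move=> Ys; case: (pD) => _ _ _ /(_ _ Ys) [S' [DS' [le nle]]] _.
move: DS'; rewrite fixed_P_S P_S_HS => -[s' Ys' ES]; rewrite ES in le nle.
move/hle_prefix/prefixP: le => [[|b d] Es].
  by case: nle; rewrite Es cats0.
by exists b; apply: Y_prefix Ys'; apply/prefixP; exists d; rewrite Es -catA.
Qed.

Lemma Y_stable : F_stable Y.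
Proof.
have half g s s' : inF g -> (forall x, phiF g (sapp s x) = sapp s' x) -> Y s' -> Y s.
  move=> Fg E Ys; have img : gimg g (HS (sapp s')) = HS (sapp s).
    by apply: gimg_HS => //; split=> _; [exists s | exists s'].
  by rewrite /Y -img; apply: fixed_gimg => //; rewrite img; exact: positive_sapp.
move=> g s s' Fg E; split; last exact: half Fg E.
by have [h Fh hK] := F_inv Fg; apply: (half h) => // x; rewrite -E hK.
Qed.

(** Quantifying over all prefixes makes this a congruence for prepending letters, so words can be
    rewritten from right to left. *)
Definition Yeq s t := forall a, Y (a ++ s) <-> Y (a ++ t).

Lemma Yeq_cons b s t : Yeq s t -> Yeq (b :: s) (b :: t).
Proof. by move=> H a; have := H (a ++ [:: b]); rewrite -!catA. Qed.

Lemma Yeq_trans s t u : Yeq s t -> Yeq t u -> Yeq s u.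
Proof. by move=> H K a; rewrite H. Qed.

Lemma Yeq_local s t c : (forall a, exists2 g, inF g &
  forall x, phiF g (sapp (a ++ s) x) = sapp (a ++ t) x) -> Yeq (s ++ c) (t ++ c).
Proof.
move=> H a; have [g Fg Hg] := H a; apply: (Y_stable Fg) => x.
by rewrite !catA ![sapp (_ ++ c) _]sapp_cat Hg.
Qed.

Lemma Yeq_00 c : Yeq (false :: false :: c) (false :: c).
Proof.
by apply: (@Yeq_local [:: false; false] [:: false]) => a;
  have [g Fg []] := local_F a; exists g.
Qed.

Lemma Yeq_11 c : Yeq (true :: c) (true :: true :: c).
Proof.
by apply: (@Yeq_local [:: true] [:: true; true]) => a;
  have [g Fg []] := local_F a; exists g.
Qed.

Lemma Yeq_01 c : Yeq (false :: true :: c) (true :: false :: c).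
Proof.
by apply: (@Yeq_local [:: false; true] [:: true; false]) => a;
  have [g Fg []] := local_F a; exists g.
Qed.

(** The normal form under the three rewritings: one of the empty word, [0], [1] and [01]. *)
Definition letters (s : seq bool) : seq bool :=
  nseq (false \in s) false ++ nseq (true \in s) true.

Lemma Yeq_letters s : Yeq s (letters s).
Proof.
elim: s => [|b s IH]; first by [].
apply: Yeq_trans (Yeq_cons b IH) _; rewrite /letters !inE.
case: b; case: (false \in s); case: (true \in s) => //= a.
- by rewrite -Yeq_01 -(Yeq_cons false (Yeq_11 [::])).
- by rewrite Yeq_01.
- by rewrite -Yeq_11.
- by rewrite Yeq_00.
- by rewrite Yeq_00.
Qed.

Lemma Y_letters s : Y s <-> Y (letters s).
Proof. exact: (Yeq_letters s [::]). Qed.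

Lemma constant_wordE b s : ~~ b \notin s -> constant_word b s.
Proof.
move=> H; exists (size s); apply/all_pred1P; apply/allP => c cs /=.
by case: eqP => // /eqP cb; case/negP: H; move: cs cb; case: b; case: c.
Qed.

Lemma constant_Y b s : Y [:: b] -> constant_word b s -> Y s.
Proof.
move=> Yb [[|k] ->]; first exact: Y_nil.
apply/Y_letters; suff -> : letters (nseq k.+1 b) = [:: b] by [].
by rewrite /letters !mem_nseq; case: b {Yb}.
Qed.

Lemma Y_constant b s : constant_word b s -> s <> [::] -> Y s -> Y [:: b].
Proof.
move=> [[|k] ->] // _; apply: Y_prefix; exact: (@prefix_prefix _ [:: b]).
Qed.

Lemma fixed_Delta : D = Delta_L \/ D = Delta_R \/ D = Delta_LR \/ D = Delta_inf.
Proof.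
rewrite fixed_P_S Delta_L_E Delta_R_E Delta_LR_E.
case: (classic (Y [:: false; true])) => [mix|nmix].
  do 3 right; apply: P_S_ext => s; split => // _.
  (* The words [01] and [s01] contain the same letters, so [s01] and with it its prefix [s] belong
     to [Y]. *)
  apply: (Y_prefix (prefix_prefix s [:: false; true])); apply/Y_letters.
  by rewrite /letters !mem_cat !inE !orbT.
(* Without [01], no word of [Y] contains both letters. *)
have cst s : Y s -> constant_word false s \/ constant_word true s.
  case: (boolP (true \in s)) => [t_s|]; last by move=> ? _; left; apply: constant_wordE.
  case: (boolP (false \in s)) => [f_s|]; last by move=> ? _; right; apply: constant_wordE.
  by move/Y_letters; rewrite /letters t_s f_s.
have only b : (forall s, Y s -> constant_word (~~ b) s -> constant_word b s) -> Y [:: b] ->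
    forall s, Y s <-> constant_word b s.
  move=> H Yb s; split=> [Ys|]; last exact: constant_Y.
  by case: b H {Yb} => H; case: (cst _ Ys) => // c; apply: H.
have one b : ~ Y [:: b] -> forall s, Y s -> constant_word b s -> constant_word (~~ b) s.
  move=> nb [|c s] Ys Hs; first by exists 0.
  by case: nb; apply: Y_constant Hs _ Ys.
case: (classic (Y [:: false])) => Y0; case: (classic (Y [:: true])) => Y1.
- do 2 right; left; apply: P_S_ext => s; split; first exact: cst.
  by case; apply: constant_Y.
- left; apply: P_S_ext; apply: only => // s Ys Hs; exact: (one true).
- right; left; apply: P_S_ext; apply: only => // s Ys Hs; exact: (one false).
(* With neither letter in [Y], the empty word would be maximal. *)
- by case: (Y_next Y_nil) => -[].
Qed.

End FixedProfile.

Theorem theorem5p1 :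
  (forall H : hspace -> Prop,
     profile H /\ fixed_by_F H <->
     H = Delta_L \/ H = Delta_R \/ H = Delta_LR \/ H = Delta_inf) /\
  (Delta_L <> Delta_R /\ Delta_L <> Delta_LR /\ Delta_L <> Delta_inf /\
   Delta_R <> Delta_LR /\ Delta_R <> Delta_inf /\ Delta_LR <> Delta_inf).
Proof.
split=> [H|].
  split=> [[pH fH]|[->|[->|[->|->]]]]; first exact: fixed_Delta.
  - exact: P_S_constant_fixed_profile.
  - exact: P_S_constant_fixed_profile.
  - exact: Delta_LR_fixed_profile.
  - exact: Delta_inf_fixed_profile.
have W b s : constant_word b s -> forall c, c \in s -> c = b.
  by move=> [k ->] c; rewrite mem_nseq => /andP [_ /eqP].
have K b : constant_word b [:: b] by exists 1.
have nK b : ~ constant_word b [:: ~~ b].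
  by move/W => /(_ (~~ b)); rewrite inE eqxx => /(_ isT); case: b.
have M b : ~ constant_word b [:: false; true].
  by move/W => H; have := H false isT; rewrite -(H true isT).
(* The words [0], [1] and [01] tell the four sets apart. *)
rewrite Delta_L_E Delta_R_E Delta_LR_E.
split=> [E|]; first exact: (nK true) (P_S_sub E (K false)).
split=> [E|]; first exact: (nK false) (P_S_sub (esym E) (or_intror (K true))).
split=> [E|]; first exact: (M false) (P_S_sub (esym E) I).
split=> [E|]; first exact: (nK true) (P_S_sub (esym E) (or_introl (K false))).
split=> [E|E]; first exact: (M true) (P_S_sub (esym E) I).
by case: (P_S_sub (esym E) (s := [:: false; true]) I) => /M.
Qed.
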